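(* Let $(\mathcal M,g)$ be a conformally recurrent pseudo-Riemannian manifold of dimension $n\ge 5$ with recurrence vector $\alpha_i$ such that $\alpha^2=\alpha^k\alpha_k\ne 0$, and let $E_{il}=\frac{\alpha^j\alpha^k}{\alpha^2}C_{ijkl}$. Then the Weyl tensor has the form $$C_{jklm}=\frac{1}{n-3}\left[g_{mk}E_{jl}-g_{mj}E_{kl}+g_{jl}E_{km}-g_{kl}E_{jm}\right]-\frac{n-2}{n-3}\left[\frac{\alpha_k\alpha_m}{\alpha^2}E_{jl}-\frac{\alpha_j\alpha_m}{\alpha^2}E_{kl}+\frac{\alpha_j\alpha_l}{\alpha^2}E_{km}-\frac{\alpha_k\alpha_l}{\alpha^2}E_{jm}\right].$$
   Context: Manifolds are smooth, connected, Hausdorff, with a non-degenerate metric $g$ of arbitrary signature and Levi-Civita connection $\nabla$. Conventions: $[\nabla_j,\nabla_k]v_l=R_{jkl}{}^m v_m$, $R_{kl}=-R_{mkl}{}^m$ (Ricci tensor), $R=g^{ij}R_{ij}$. The Weyl tensor is $$C_{jkl}{}^m=R_{jkl}{}^m+\tfrac{1}{n-2}(\delta_j{}^mR_{kl}-\delta_k{}^mR_{jl}+R_j{}^mg_{kl}-R_k{}^mg_{jl})-R\,\frac{\delta_j{}^mg_{kl}-\delta_k{}^mg_{jl}}{(n-1)(n-2)}.$$ $(\mathcal M,g)$ is conformally recurrent if $\nabla_iC_{jklm}=\alpha_iC_{jklm}$ for a non-zero covector field $\alpha_i$, called the recurrence vector. *)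

(* Defs.v *)
From HB Require Import structures.
From mathcomp Require Import all_boot all_order all_algebra.
From mathcomp Require Import all_classical all_reals all_analysis.
From mathcomp Require Import ring.

Set Implicit Arguments.
Unset Strict Implicit.
Unset Printing Implicit Defensive.

Import Order.TTheory GRing.Theory Num.Theory.
Import numFieldNormedType.Exports.

Local Open Scope classical_set_scope.
Local Open Scope ring_scope.

Section Smooth.
Variables (R : realType) (n : nat).
Implicit Types (U : set 'rV[R]_n) (f : 'rV[R]_n -> R).

Definition pd (i : 'I_n) f : 'rV[R]_n -> R := fun x => 'D_(delta_mx 0 i) f x.

(* Class C^k on U; meaningful for U open. *)
Fixpoint Ck_on (k : nat) U f : Prop :=
  (forall x, U x -> {for x, continuous f}) /\
  (if k is k'.+1 then
     forall i : 'I_n,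
       (forall x, U x -> derivable f x (delta_mx 0 i)) /\ Ck_on k' U (pd i f)
   else True).

Definition smooth_on U f : Prop := forall k, Ck_on k U f.

Definition smooth_map_on U (F : 'rV[R]_n -> 'rV[R]_n) : Prop :=
  forall a : 'I_n, smooth_on U (fun x => F x 0 a).

End Smooth.

Section Manifold.
Variables (R : realType) (n : nat).

(* A homeomorphism between an open subset of M and an open subset of R^n.
   Outside cdom (resp. outside its image) cmap (resp. cinv) is arbitrary. *)
Record chart (M : topologicalType) := Chart {
  cdom : set M;
  cmap : M -> 'rV[R]_n;
  cinv : 'rV[R]_n -> M;
  cdom_open : open cdom;
  cimg_open : open (cmap @` cdom);
  cmapK : forall p, cdom p -> cinv (cmap p) = p;
  cmap_continuous : forall p, cdom p -> {for p, continuous cmap};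
  cinv_continuous : forall x, (cmap @` cdom) x -> {for x, continuous cinv}
}.

Definition cimg (M : topologicalType) (c : chart M) : set 'rV[R]_n :=
  cmap c @` cdom c.

Definition overlap (M : topologicalType) (c d : chart M) : set 'rV[R]_n :=
  cmap c @` (cdom c `&` cdom d).

Definition transition (M : topologicalType) (c d : chart M) :
  'rV[R]_n -> 'rV[R]_n := fun x => cmap d (cinv c x).

(* jac c d x a i = d y^a / d x^i, with x the c-coordinates and y the
   d-coordinates. *)
Definition jac (M : topologicalType) (c d : chart M) (x : 'rV[R]_n)
  (a i : 'I_n) : R := pd i (fun z => transition c d z 0 a) x.

Record manifold := Manifold {
  mcarrier :> topologicalType;
  atlas : set (chart mcarrier);
  manifold_hausdorff : hausdorff_space mcarrier;
  manifold_connected : connected [set: mcarrier];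
  atlas_cover : forall p : mcarrier, exists2 c, atlas c & cdom c p;
  atlas_smooth : forall c d, atlas c -> atlas d ->
    smooth_map_on (overlap c d) (transition c d)
}.

Variable M : manifold.

(* Tensor fields are given by their components in every chart of the atlas,
   as functions of the coordinates, subject to the tensor transformation law. *)

Record metric := Metric {
  gcomp :> chart M -> 'rV[R]_n -> 'M[R]_n;
  metric_smooth : forall c, atlas c ->
    forall i j, smooth_on (cimg c) (fun x => gcomp c x i j);
  metric_sym : forall c, atlas c -> forall x, cimg c x ->
    forall i j, gcomp c x i j = gcomp c x j i;
  metric_nondegenerate : forall c, atlas c -> forall x, cimg c x ->
    gcomp c x \in unitmx;
  metric_transform : forall c d, atlas c -> atlas d ->
    forall x, overlap c d x -> forall i j,
    gcomp c x i j = \sum_(a < n) \sum_(b < n)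
      jac c d x a i * jac c d x b j * gcomp d (transition c d x) a b
}.

Record covector_field := CovectorField {
  vcomp :> chart M -> 'I_n -> 'rV[R]_n -> R;
  covector_smooth : forall c, atlas c ->
    forall i, smooth_on (cimg c) (vcomp c i);
  covector_transform : forall c d, atlas c -> atlas d ->
    forall x, overlap c d x -> forall i,
    vcomp c i x = \sum_(a < n) jac c d x a i * vcomp d a (transition c d x)
}.

End Manifold.

Section LocalGeometry.
Variables (R : realType) (n : nat).
Variable g : 'rV[R]_n -> 'M[R]_n.
Implicit Types (x : 'rV[R]_n) (i j k l m p q : 'I_n).

Definition ginv x : 'M[R]_n := invmx (g x).

Definition dg i j k : 'rV[R]_n -> R := pd i (fun y => g y j k).

(* Gamma_ij^k of the Levi-Civita connection. *)
Definition christoffel i j k x : R :=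
  2^-1 * \sum_(m < n) ginv x k m * (dg i j m x + dg j i m x - dg m i j x).

(* Covariant derivative of covariant tensors; the first index of the result
   is the direction of derivation. *)
Definition nabla1 (v : 'I_n -> 'rV[R]_n -> R) i j x : R :=
  pd i (v j) x - \sum_(p < n) christoffel i j p x * v p x.

Definition nabla2 (T : 'I_n -> 'I_n -> 'rV[R]_n -> R) i j k x : R :=
  pd i (T j k) x
  - \sum_(p < n) christoffel i j p x * T p k x
  - \sum_(p < n) christoffel i k p x * T j p x.

Definition nabla4 (T : 'I_n -> 'I_n -> 'I_n -> 'I_n -> 'rV[R]_n -> R)
  i j k l m x : R :=
  pd i (T j k l m) x
  - \sum_(p < n) christoffel i j p x * T p k l m x
  - \sum_(p < n) christoffel i k p x * T j p l m x
  - \sum_(p < n) christoffel i l p x * T j k p m x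
  - \sum_(p < n) christoffel i m p x * T j k l p x.

Definition delta i j : R := (i == j)%:R.

(* Components of the coordinate covector field dx^m. *)
Definition dx m : 'I_n -> 'rV[R]_n -> R := fun l _ => delta l m.

(* R_jkl^m. The convention [nabla_j, nabla_k] v_l = R_jkl^m v_m is read off
   at v = dx^m; see ricci_identity below for arbitrary v. *)
Definition riemann j k l m x : R :=
  nabla2 (nabla1 (dx m)) j k l x - nabla2 (nabla1 (dx m)) k j l x.

Definition ricci k l x : R := - \sum_(m < n) riemann m k l m x.

(* R_j^m *)
Definition ricci_mixed j m x : R := \sum_(p < n) ricci j p x * ginv x p m.

Definition scalar_curvature x : R :=
  \sum_(i < n) \sum_(j < n) ginv x i j * ricci i j x.

(* C_jkl^m *)
Definition weyl_mixed j k l m x : R :=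
  riemann j k l m x
  + (n%:R - 2)^-1 *
      (delta j m * ricci k l x - delta k m * ricci j l x
       + ricci_mixed j m x * g x k l - ricci_mixed k m x * g x j l)
  - scalar_curvature x *
      ((delta j m * g x k l - delta k m * g x j l)
       / ((n%:R - 1) * (n%:R - 2))).

(* C_jklm *)
Definition weyl j k l m x : R := \sum_(p < n) weyl_mixed j k l p x * g x p m.

Variable alpha : 'I_n -> 'rV[R]_n -> R.

(* alpha^k *)
Definition raise k x : R := \sum_(p < n) ginv x k p * alpha p x.

(* alpha^2 = alpha^k alpha_k *)
Definition sqnorm x : R := \sum_(k < n) raise k x * alpha k x.

(* E_il *)
Definition weylE i l x : R :=
  \sum_(j < n) \sum_(k < n)
    raise j x * raise k x / sqnorm x * weyl i j k l x.

End LocalGeometry.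

(* "Non-zero" recurrence vector is read as: not identically zero on M. *)
Definition conformally_recurrent (R : realType) (n : nat) (M : manifold R n)
  (g : metric M) (alpha : covector_field M) : Prop :=
  (exists c : chart R n M, atlas c /\
     exists x, cimg c x /\ exists i, alpha c i x != 0) /\
  (forall c : chart R n M, atlas c -> forall x, cimg c x ->
     forall i j k l m,
       nabla4 (g c) (weyl (g c)) i j k l m x
       = alpha c i x * weyl (g c) j k l m x).

Section LeviCivita.
Variables (R : realType) (n : nat) (g : 'rV[R]_n -> 'M[R]_n) (x : 'rV[R]_n).
Hypothesis g_sym : \forall y \near x, forall i j, g y i j = g y j i.
Hypothesis g_unit : g x \in unitmx.
Implicit Types (i j k l m p q : 'I_n).

Lemma dg_sym i j k : dg g i j k x = dg g i k j x.
Proof.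
have e0 : (delta_mx 0 i : 'rV[R]_n) != 0.
  by apply/eqP => /matrixP/(_ 0 i)/eqP; rewrite !mxE !eqxx oner_eq0.
apply: near_eq_derive => //.
by near=> y; apply: (near g_sym).
Unshelve. all: by end_near. Qed.

Lemma christoffel_torsion_free i j k :
  christoffel g i j k x = christoffel g j i k x.
Proof.
rewrite /christoffel; congr (_ * _); apply: eq_bigr => m _.
by rewrite (dg_sym m i j) (addrC (dg g i j m x)).
Qed.

Lemma christoffel_lower i j k :
  \sum_(p < n) christoffel g i j p x * g x p k =
  2^-1 * (dg g i j k x + dg g j i k x - dg g k i j x).
Proof.
have gs := nbhs_singleton g_sym.
rewrite /christoffel.
under eq_bigr => p _ do rewrite -mulrA mulr_suml.
rewrite -mulr_sumr exchange_big /=; congr (_ * _).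
have Einv m : \sum_(p < n) ginv g x p m * g x p k = (k == m)%:R.
  have /matrixP/(_ k m) := mulmxV g_unit; rewrite !mxE => <-.
  by apply: eq_bigr => p _; rewrite mulrC gs.
under eq_bigr => m _.
  under eq_bigr => p _ do rewrite mulrAC.
  rewrite -mulr_suml Einv; over.
rewrite (bigD1 k) //= eqxx mul1r big1 ?addr0 // => m mk.
by rewrite eq_sym (negbTE mk) mul0r.
Qed.

Lemma christoffel_metric i j k :
  nabla2 g (fun j k y => g y j k) i j k x = 0.
Proof.
have gs := nbhs_singleton g_sym.
rewrite /nabla2 christoffel_lower //.
under [X in _ - _ - X]eq_bigr => p _ do rewrite gs.
rewrite christoffel_lower // (dg_sym i k j) (dg_sym k i j) (dg_sym j i k).
rewrite -/(dg g i j k x).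
by field.
Qed.

End LeviCivita.

Section RicciIdentity.
Variables (R : realType) (n : nat) (g : 'rV[R]_n -> 'M[R]_n) (x : 'rV[R]_n).
Hypothesis torsion_free : forall i j k,
  christoffel g i j k x = christoffel g j i k x.
Hypothesis christoffel_derivable : forall i j k l,
  derivable (christoffel g i j k) x (delta_mx 0 l).
Implicit Types (i j k l m p q : 'I_n).

Lemma nabla1_dx m k l y : nabla1 g (dx m) k l y = - christoffel g k l m y.
Proof.
rewrite /nabla1 (_ : pd k _ y = 0); last exact: derive_cst.
rewrite sub0r (bigD1 m) //= big1 => [|p pm].
  by rewrite /dx /delta eqxx mulr1 addr0.
by rewrite /dx /delta (negbTE pm) mulr0.
Qed.

Lemma pd_nabla1 (v : 'I_n -> 'rV[R]_n -> R) j k l :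
  (forall p, derivable (v p) x (delta_mx 0 j)) ->
  derivable (pd k (v l)) x (delta_mx 0 j) ->
  pd j (nabla1 g v k l) x = pd j (pd k (v l)) x
   - \sum_(p < n) (christoffel g k l p x * pd j (v p) x
                   + v p x * pd j (christoffel g k l p) x).
Proof.
move=> dv ddv.
have -> : nabla1 g v k l =
    pd k (v l) - \sum_(p < n) (christoffel g k l p * v p).
  apply/funext => y; rewrite /nabla1 [RHS]/= -[LHS]/(_ - _).
  by rewrite /GRing.opp /= /GRing.add /= fct_sumE.
have dp p : derivable (christoffel g k l p * v p) x (delta_mx 0 j).
  by apply: derivableM; [apply: christoffel_derivable | apply: dv].
apply: etrans (deriveB ddv (derivable_sum dp)) _; congr (_ - _).
apply: etrans (derive_sum dp) _; apply: eq_bigr => p _.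
exact: deriveM (@christoffel_derivable k l p j) (dv p).
Qed.

Lemma riemannE j k l m : riemann g j k l m x =
  pd k (christoffel g j l m) x - pd j (christoffel g k l m) x
  + \sum_(p < n) christoffel g j l p x * christoffel g k p m x
  - \sum_(p < n) christoffel g k l p x * christoffel g j p m x.
Proof.
have E a b : pd a (nabla1 g (dx m) b l) x = - pd a (christoffel g b l m) x.
  have -> : nabla1 g (dx m) b l = - christoffel g b l m.
    by apply/funext => y; rewrite nabla1_dx.
  by rewrite /pd deriveN.
rewrite /riemann /nabla2 !E.
have T : \sum_(p < n) christoffel g j k p x * nabla1 g (dx m) p l x
  = \sum_(p < n) christoffel g k j p x * nabla1 g (dx m) p l x.
  by apply: eq_bigr => p _; rewrite torsion_free.
have S a b : \sum_(p < n) christoffel g a l p x * nabla1 g (dx m) b p x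
  = - \sum_(p < n) christoffel g a l p x * christoffel g b p m x.
  by rewrite -sumrN; apply: eq_bigr => p _; rewrite nabla1_dx mulrN.
have alg (P Q A B U U' X Y : R) : U = U' -> X = - A -> Y = - B ->
    (- P - U - X) - (- Q - U' - Y) = Q - P + A - B.
  by move=> -> -> ->; ring.
exact: alg T (S j k) (S k j).
Qed.

Lemma ricci_identity (v : 'I_n -> 'rV[R]_n -> R) j k l :
  (forall p q, derivable (v p) x (delta_mx 0 q)) ->
  (forall p q, derivable (pd p (v l)) x (delta_mx 0 q)) ->
  pd j (pd k (v l)) x = pd k (pd j (v l)) x ->
  nabla2 g (nabla1 g v) j k l x - nabla2 g (nabla1 g v) k j l x
  = \sum_(m < n) riemann g j k l m x * v m x.
Proof.
move=> dv ddv schwarz.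
have N a b : pd a (nabla1 g v b l) x = pd a (pd b (v l)) x
   - (\sum_(p < n) christoffel g b l p x * pd a (v p) x
      + \sum_(p < n) v p x * pd a (christoffel g b l p) x).
  by rewrite -big_split; apply: pd_nabla1.
have T : \sum_(p < n) christoffel g j k p x * nabla1 g v p l x
  = \sum_(p < n) christoffel g k j p x * nabla1 g v p l x.
  by apply: eq_bigr => p _; rewrite torsion_free.
have S a b : \sum_(p < n) christoffel g a l p x * nabla1 g v b p x
  = \sum_(p < n) christoffel g a l p x * pd b (v p) x
    - \sum_(m < n) (\sum_(p < n) christoffel g a l p x
                                 * christoffel g b p m x) * v m x.
  under [X in _ - X]eq_bigr => m _ do rewrite mulr_suml.
  rewrite exchange_big /= -sumrB; apply: eq_bigr => p _.
  rewrite /nabla1 mulrBr mulr_sumr; congr (_ - _).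
  by apply: eq_bigr => m _; rewrite mulrA.
have V : \sum_(m < n) riemann g j k l m x * v m x
  = \sum_(m < n) v m x * pd k (christoffel g j l m) x
  - \sum_(m < n) v m x * pd j (christoffel g k l m) x
  + \sum_(m < n) (\sum_(p < n) christoffel g j l p x
                               * christoffel g k p m x) * v m x
  - \sum_(m < n) (\sum_(p < n) christoffel g k l p x
                               * christoffel g j p m x) * v m x.
  rewrite -sumrB -big_split -sumrB; apply: eq_bigr => m _.
  have alg (a b c d w : R) :
      (a - b + c - d) * w = w * a - w * b + c * w - d * w by ring.
  by rewrite riemannE; exact: alg.
have alg (D D' P Q A B X Y U U' W Z r F H : R) : D = D' ->
    F = D - (B + P) -> H = D' - (A + Q) ->
    U = U' -> W = A - X -> Z = B - Y -> r = Q - P + X - Y ->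
    (F - U - W) - (H - U' - Z) = r.
  by move=> -> -> -> -> -> -> ->; ring.
exact: alg schwarz (N j k) (N k j) T (S j k) (S k j) V.
Qed.

End RicciIdentity.

(* Main.v *)
Require Import Defs.
From mathcomp Require Import all_boot all_order all_algebra.
From mathcomp Require Import all_classical all_reals all_analysis.
From mathcomp Require Import ring lra.

(* Since g is parallel and C = R + g /\ S, with S the Schouten tensor and /\ the
   Kulkarni-Nomizu product, the second Bianchi identity for R expresses the
   cyclic sum of nabla_i C_jklm through g and T_ikl = nabla_i S_kl - nabla_k S_il.
   For nabla C = alpha C the left-hand side is algebraic in C.  Taking traces
   shows that T is trace-free and that (3 - n) T_jkl = D_jkl := alpha^m C_jklm;
   contracting with alpha^i alpha^m gives (n - 4) D_jkl =
   (n - 4) (alpha_j E_kl - alpha_k E_jl), and contracting with alpha^i alone then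
   solves for C. *)

Set Implicit Arguments.
Unset Strict Implicit.
Unset Printing Implicit Defensive.

Import Order.TTheory GRing.Theory Num.Theory.
Import numFieldNormedType.Exports.
Local Open Scope classical_set_scope.
Local Open Scope ring_scope.

(** * Calculus of C^k and smooth functions on an open set *)

Section PartialDerivatives.
Variables (R : realType) (n : nat) (U : set 'rV[R]_n).
Hypothesis U_open : open U.
Implicit Types (f h : 'rV[R]_n -> R) (i j : 'I_n).

(** The analytic input is the symmetry of mixed partial derivatives, used twice: for g it makes the
    lowered curvature antisymmetric in its last two indices, and for the Christoffel symbols it
    yields the second Bianchi identity. Both become matrix identities once the connection is a
    family of matrices G_i acting on covectors, with d_i g = G_i g + g G_i^T and R_jk = d_k G_j -
    d_j G_k + [G_j, G_k]. What follows is linear algebra at a single point. There T enters only as a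
    tensor antisymmetric in its first two indices. Its trace and its proportionality to D,
    classically read off the contracted Bianchi identities, are forced here by the trace-freeness of
    C itself, so nabla is never commuted with a contraction. The obstacle is that contracting with
    alpha^i leaves D beside C. A further contraction must determine D through E, and its coefficient
    is n - 4. *)

Definition pderivable f :=
  forall x, U x -> forall i, derivable f x (delta_mx 0 i).

Lemma Ck_onS k f : Ck_on k.+1 U f -> Ck_on k U f.
Proof.
elim: k f => [|k IH] f [cf df]; first by split.
split=> // i; have [dfi Cf] := df i; split=> //; exact: IH.
Qed.

Lemma eq_on_near f h x : {in U, f =1 h} -> U x -> \near x, f x = h x.
Proof.
move=> fh Ux; have := open_nbhs_nbhs (conj U_open Ux).
by apply: filterS => y Uy; apply: fh; rewrite inE.
Qed.

Lemma eq_on_continuous f h x : {in U, f =1 h} -> U x ->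
  {for x, continuous f} -> {for x, continuous h}.
Proof.
move=> fh Ux; rewrite /prop_for /continuous_at (fh x (mem_set Ux)).
apply: cvg_trans; exact: (@near_eq_cvg _ _ (nbhs x) _ f h (eq_on_near fh Ux)).
Qed.

Lemma eq_on_pd f h i : {in U, f =1 h} -> {in U, pd i f =1 pd i h}.
Proof.
move=> fh x /[!inE] Ux; apply: near_eq_derive (eq_on_near fh Ux).
Qed.

(** Continuity and derivability at a point of the open set [U] depend only on the germ there. The
    differentiation rules hold at points of [U] and not as equalities of functions, so every closure
    property below passes through this transfer. *)
Lemma eq_on_Ck k f h : {in U, f =1 h} -> Ck_on k U f -> Ck_on k U h.
Proof.
elim: k f h => [|k IH] f h fh [cf df].
  by split=> // x Ux; apply: eq_on_continuous fh Ux (cf x Ux).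
split=> [x Ux|i]; first exact: eq_on_continuous fh Ux (cf x Ux).
have [dfi Cf] := df i; split; last exact: IH (eq_on_pd i fh) Cf.
by move=> x Ux; apply: near_eq_derivable (eq_on_near fh Ux) (dfi x Ux).
Qed.

Lemma eq_on_smooth f h : {in U, f =1 h} -> smooth_on U f -> smooth_on U h.
Proof. by move=> fh sf k; exact: eq_on_Ck fh (sf k). Qed.

Lemma smooth_pderivable f : smooth_on U f -> pderivable f.
Proof. by move=> /(_ 1) [_ df] x Ux i; have [/(_ x Ux)] := df i. Qed.

Lemma smooth_pd f i : smooth_on U f -> smooth_on U (pd i f).
Proof. by move=> sf k; have [_ /(_ i)[]] := sf k.+1. Qed.

Lemma pdD f h i : pderivable f -> pderivable h ->
  {in U, pd i (fun x => f x + h x) =1 fun x => pd i f x + pd i h x}.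
Proof. by move=> df dh x /[!inE] Ux; apply: deriveD; [exact: df|exact: dh]. Qed.

Lemma pdB f h i : pderivable f -> pderivable h ->
  {in U, pd i (fun x => f x - h x) =1 fun x => pd i f x - pd i h x}.
Proof. by move=> df dh x /[!inE] Ux; apply: deriveB; [exact: df|exact: dh]. Qed.

Lemma pdN f i : pderivable f ->
  {in U, pd i (fun x => - f x) =1 fun x => - pd i f x}.
Proof. by move=> df x /[!inE] Ux; apply: deriveN; exact: df. Qed.

Lemma pdM f h i : pderivable f -> pderivable h ->
  {in U, pd i (fun x => f x * h x) =1 fun x => f x * pd i h x + h x * pd i f x}.
Proof. by move=> df dh x /[!inE] Ux; apply: deriveM; [exact: df|exact: dh]. Qed.

Lemma pdV f i : {in U, forall x, f x != 0} -> pderivable f ->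
  {in U, pd i (fun x => (f x)^-1) =1
         fun x => - ((f x)^-1 * (f x)^-1 * pd i f x)}.
Proof.
move=> f0 df x Ux.
rewrite /pd; have := deriveV (f0 x Ux) (df x (set_mem Ux) i).
by move=> ->; rewrite expr2 invfM scaleNr.
Qed.

Lemma Ck_cst k (c : R) : Ck_on k U (fun=> c).
Proof.
elim: k c => [|k IH] c; first by split=> // x _; exact: cst_continuous.
split=> [x _|i]; first exact: cst_continuous.
split=> [x _|]; first exact: derivable_cst.
by apply: eq_on_Ck (IH 0) => x _; rewrite /pd derive_cst.
Qed.

Lemma Ck_pderivable k f : Ck_on k.+1 U f -> pderivable f.
Proof. by move=> [_ df] x Ux i; have [/(_ x Ux)] := df i. Qed.

Lemma CkD k f h : Ck_on k U f -> Ck_on k U h -> Ck_on k U (fun x => f x + h x).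
Proof.
elim: k f h => [|k IH] f h Cf Ch; move: (Cf) (Ch) => [cf df] [ch dh].
  by split=> // x Ux; apply: continuousD; [exact: cf|exact: ch].
split=> [x Ux|i]; first by apply: continuousD; [exact: cf|exact: ch].
have [dfi Cfi] := df i; have [dhi Chi] := dh i; split=> [x Ux|].
  by apply: derivableD; [exact: dfi|exact: dhi].
apply: eq_on_Ck (IH _ _ Cfi Chi) => x Ux.
by rewrite pdD//; [exact: Ck_pderivable Cf|exact: Ck_pderivable Ch].
Qed.

(** The product rule involves [f] and [h] undifferentiated, so the induction uses them one class
    lower, through [Ck_onS]. *)
Lemma CkM k f h : Ck_on k U f -> Ck_on k U h -> Ck_on k U (fun x => f x * h x).
Proof.
elim: k f h => [|k IH] f h Cf Ch; move: (Cf) (Ch) => [cf df] [ch dh].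
  by split=> // x Ux; apply: continuousM; [exact: cf|exact: ch].
split=> [x Ux|i]; first by apply: continuousM; [exact: cf|exact: ch].
have [dfi Cfi] := df i; have [dhi Chi] := dh i; split=> [x Ux|].
  by apply: derivableM; [exact: dfi|exact: dhi].
apply: eq_on_Ck (CkD (IH _ _ (Ck_onS Cf) Chi) (IH _ _ (Ck_onS Ch) Cfi)) => x Ux.
by rewrite pdM//; [exact: Ck_pderivable Cf|exact: Ck_pderivable Ch].
Qed.

Lemma CkV k f : {in U, forall x, f x != 0} -> Ck_on k U f ->
  Ck_on k U (fun x => (f x)^-1).
Proof.
move=> f0; elim: k => [|k IH] Cf; move: (Cf) => [cf df].
  by split=> // x Ux; apply: continuousV; [apply: f0; rewrite inE|exact: cf].
split=> [x Ux|i].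
  by apply: continuousV; [apply: f0; rewrite inE|exact: cf].
have [dfi Cfi] := df i; split=> [x Ux|].
  by apply: derivableV; [apply: f0; rewrite inE|exact: dfi].
(* The derivative of 1/f contains 1/f again, but only to order [k], which the induction hypothesis
   provides. *)
have CV := IH (Ck_onS Cf).
apply: eq_on_Ck (CkM (Ck_cst k (-1)) (CkM (CkM CV CV) Cfi)) => x Ux.
by rewrite pdV// ?mulN1r//; exact: Ck_pderivable Cf.
Qed.

Lemma smooth_cst (c : R) : smooth_on U (fun=> c).
Proof. by move=> k; exact: Ck_cst. Qed.

Lemma smoothD f h : smooth_on U f -> smooth_on U h ->
  smooth_on U (fun x => f x + h x).
Proof. by move=> sf sh k; exact: CkD. Qed.

Lemma smoothM f h : smooth_on U f -> smooth_on U h ->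
  smooth_on U (fun x => f x * h x).
Proof. by move=> sf sh k; exact: CkM. Qed.

Lemma smoothV f : {in U, forall x, f x != 0} -> smooth_on U f ->
  smooth_on U (fun x => (f x)^-1).
Proof. by move=> f0 sf k; exact: CkV. Qed.

Lemma smoothN f : smooth_on U f -> smooth_on U (fun x => - f x).
Proof.
move=> sf; apply: eq_on_smooth (smoothM (smooth_cst (-1)) sf) => x _.
by rewrite mulN1r.
Qed.

Lemma smoothB f h : smooth_on U f -> smooth_on U h ->
  smooth_on U (fun x => f x - h x).
Proof. by move=> sf sh; apply: smoothD => //; exact: smoothN. Qed.

Lemma smooth_sum (I : Type) (r : seq I) (P : pred I)
    (F : I -> 'rV[R]_n -> R) : (forall a, smooth_on U (F a)) ->
  smooth_on U (fun x => \sum_(i <- r | P i) F i x).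
Proof.
move=> sF; elim: r => [|a r IH].
  by apply: eq_on_smooth (smooth_cst 0) => x _; rewrite big_nil.
case Pa: (P a).
  by apply: eq_on_smooth (smoothD (sF a) IH) => x _; rewrite big_cons Pa.
by apply: eq_on_smooth IH => x _; rewrite big_cons Pa.
Qed.

Lemma smooth_prod (I : Type) (r : seq I) (P : pred I)
    (F : I -> 'rV[R]_n -> R) : (forall a, smooth_on U (F a)) ->
  smooth_on U (fun x => \prod_(i <- r | P i) F i x).
Proof.
move=> sF; elim: r => [|a r IH].
  by apply: eq_on_smooth (smooth_cst 1) => x _; rewrite big_nil.
case Pa: (P a).
  by apply: eq_on_smooth (smoothM (sF a) IH) => x _; rewrite big_cons Pa.
by apply: eq_on_smooth IH => x _; rewrite big_cons Pa.
Qed.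

Lemma pd_sum (F : 'I_n -> 'rV[R]_n -> R) i : (forall p, pderivable (F p)) ->
  {in U, pd i (fun x => \sum_p F p x) =1 fun x => \sum_p pd i (F p) x}.
Proof.
move=> dF x /[!inE] Ux; rewrite /pd -derive_sum => [|p]; last exact: dF.
by congr (derive _ _ _); apply/funext => y; rewrite fct_sumE.
Qed.

Lemma smooth_det p (A : 'rV[R]_n -> 'M[R]_p) :
  (forall a b, smooth_on U (fun x => A x a b)) ->
  smooth_on U (fun x => \det (A x)).
Proof.
move=> sA; rewrite /determinant; apply: smooth_sum => s.
by apply: smoothM; [exact: smooth_cst|apply: smooth_prod].
Qed.

(** Cramer's rule: cofactors divided by the determinant. Since [invmx] is the identity map on
    singular matrices, the formula holds on [U] only. *)
Lemma smooth_invmx p (A : 'rV[R]_n -> 'M[R]_p) :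
  {in U, forall x, A x \in unitmx} ->
  (forall a b, smooth_on U (fun x => A x a b)) ->
  forall a b, smooth_on U (fun x => invmx (A x) a b).
Proof.
move=> uA sA a b.
have sdet : smooth_on U (fun x => (\det (A x))^-1).
  apply: smoothV; last exact: smooth_det.
  by move=> x /uA; rewrite unitmxE unitfE.
suff sadj : smooth_on U (fun x => \adj (A x) a b).
  apply: eq_on_smooth (smoothM sdet sadj) => x Ux.
  by rewrite /invmx (uA x Ux) !mxE.
apply: (@eq_on_smooth (fun x => (-1) ^+ (b + a) * \det (row' b (col' a (A x))))).
  by move=> x _; rewrite mxE.
apply: smoothM; first exact: smooth_cst.
apply: smooth_det => k l.
by apply: eq_on_smooth (sA (lift b k) (lift a l)) => x _; rewrite !mxE.
Qed.

End PartialDerivatives.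

(** * Symmetry of second directional derivatives *)

Section Schwarz.
Variables (R : realType) (V : normedModType R).
Implicit Types (f : V -> R) (x v w : V).

Lemma is_derive_line f x v (s : R) : derivable f (x + s *: v) v ->
  is_derive s 1 (fun t : R => f (x + t *: v)) ('D_v f (x + s *: v)).
Proof.
move=> df.
have E :
  (fun h : R => h^-1 *: (f (x + (h *: (1 : R) + s) *: v) - f (x + s *: v))) =
         (fun h : R => h^-1 *: (f (h *: v + (x + s *: v)) - f (x + s *: v))).
  apply/funext => h; rewrite -[h *: (1 : R)]/(h * 1) mulr1 scalerDl addrCA.
  by [].
apply: DeriveDef; first by rewrite /derivable /= E.
by rewrite /derive /= E.
Qed.

Lemma MVT_line f x v (h : R) : 0 < h ->
  (forall s, 0 <= s <= h -> derivable f (x + s *: v) v) ->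
  exists2 s, 0 <= s <= h & f (x + h *: v) - f x = h * 'D_v f (x + s *: v).
Proof.
move=> h0 df.
have D (s : R) : 0 <= s <= h ->
    is_derive s 1 (fun t : R => f (x + t *: v)) ('D_v f (x + s *: v)).
  by move=> /df; exact: is_derive_line.
have [s||s] := @MVT R (fun t => f (x + t *: v))
  (fun t => 'D_v f (x + t *: v)) 0 h h0.
- by rewrite in_itv/= => /andP[s0 sh]; apply: D; rewrite !ltW.
- apply: derivable_within_continuous => s; rewrite in_itv/= => /D[].
  by [].
rewrite in_itv/= => /andP[s0 sh] E; exists s; first by rewrite !ltW.
by move: E; rewrite scale0r addr0 subr0 mulrC.
Qed.

(* The mean value theorem, first along v and then along w. *)
Lemma second_difference f x v w (h : R) (B : set V) : 0 < h ->
  (forall s t, 0 <= s <= h -> 0 <= t <= h -> B (x + s *: v + t *: w)) ->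
  (forall y, B y -> derivable f y v) ->
  (forall y, B y -> derivable ('D_v f) y w) ->
  exists2 y, B y & f (x + h *: v + h *: w) - f (x + h *: w)
     - (f (x + h *: v) - f x) = h * (h * 'D_w ('D_v f) y).
Proof.
move=> h0 xB dv dw.
have hh : 0 <= h <= h by rewrite lexx ltW.
have h00 : 0 <= (0 : R) <= h by rewrite lexx ltW.
have B0 s : 0 <= s <= h -> B (x + s *: v).
  by move=> sh; rewrite -[X in B X]addr0 -[X in B (_ + X)](scale0r w); exact: xB.
pose F y := f (y + h *: w) - f y.
have sh y : 'D_v (fun y => f (y + h *: w)) y = 'D_v f (y + h *: w).
  by rewrite /derive /=; under eq_fun => k do rewrite -addrA.
have dF s : 0 <= s <= h -> derivable (fun y => f (y + h *: w)) (x + s *: v) v.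
  move=> sh'; have := dv _ (xB s h sh' hh); rewrite /derivable /=.
  by under eq_fun => k do rewrite addrA.
have [s|s sB] := @MVT_line F x v h h0.
  by move=> sh'; apply: derivableB; [exact: dF|exact/dv/B0].
rewrite deriveB; [|exact: dF|exact/dv/B0].
rewrite sh.
have [t|t tB ->] := @MVT_line ('D_v f) (x + s *: v) w h h0.
  by move=> th; apply: dw; exact: xB.
move=> E; exists (x + s *: v + t *: w); first exact: xB.
by rewrite -E /F; ring.
Qed.

(** The second difference of [f] over the parallelogram spanned by h v and h w is symmetric in v and
    w. It therefore equals h^2 times one mixed derivative at some y and h^2 times the other at some
    z, both near x; continuity of the two mixed derivatives at x concludes. *)
Lemma derive_comm f x v w :
  (\near x, derivable f x v /\ derivable f x w) ->
  (\near x, derivable ('D_v f) x w /\ derivable ('D_w f) x v) ->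
  {for x, continuous ('D_w ('D_v f))} -> {for x, continuous ('D_v ('D_w f))} ->
  'D_w ('D_v f) x = 'D_v ('D_w f) x.
Proof.
move=> d1 d2 cvw cwv.
apply/eqP; rewrite -subr_eq0; apply/eqP/normr0_eq0/eqP.
rewrite eq_le normr_ge0 andbT; apply/ler_addgt0Pr => e e0; rewrite add0r.
have e20 : 0 < e / 2 by rewrite divr_gt0.
have : \near x, [/\ derivable f x v, derivable f x w, derivable ('D_v f) x w
  & derivable ('D_w f) x v].
  by apply: filterS2 d1 d2 => y [? ?] [? ?].
move/cvgrPdist_lt: cvw => /(_ _ e20) cvw.
move/cvgrPdist_lt: cwv => /(_ _ e20) cwv.
move=> dd; have [r /= r0 rB] :=
  iffLR (nbhs_ballP _ _) (filterI dd (filterI cvw cwv)).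
(* The summand 1 keeps [c] positive even for zero vectors. With h = r / (2c) the parallelogram has
   radius at most r / 2 around x, so it lies in the ball. *)
pose c := `|v| + `|w| + 1.
have c0 : 0 < c by rewrite ltr_wpDl// addr_ge0.
pose h := r / (2 * c).
have h0 : 0 < h by rewrite divr_gt0 // mulr_gt0.
have xB s t : 0 <= s <= h -> 0 <= t <= h -> ball x r (x + s *: v + t *: w).
  move=> /andP[s0 sh] /andP[t0 th]; rewrite -ball_normE /ball_/=.
  rewrite -addrA opprD addNKr normrN.
  apply: le_lt_trans (ler_normD _ _) _; rewrite !normrZ !ger0_norm//.
  apply: (@le_lt_trans _ _ (h * c)).
    rewrite /c !mulrDr mulr1 -[X in X <= _]addr0 lerD ?lerD ?ler_wpM2r//.
    exact: ltW.
  rewrite /h invfM mulrA mulfVK ?gt_eqF// ltr_pdivrMr// ltr_pMr// ltr1n.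
  by [].
have xB' s t : 0 <= s <= h -> 0 <= t <= h -> ball x r (x + s *: w + t *: v).
  by move=> sh th; rewrite addrAC; exact: xB.
have [y|y|y yB Ey] := @second_difference f x v w h _ h0 xB.
- by move=> /rB[[]].
- by move=> /rB[[]].
have [z|z|z zB Ez] := @second_difference f x w v h _ h0 xB'.
- by move=> /rB[[]].
- by move=> /rB[[]].
have Eyz : 'D_w ('D_v f) y = 'D_v ('D_w f) z.
  apply: (mulfI (lt0r_neq0 h0)); apply: (mulfI (lt0r_neq0 h0)).
  have alg (p q p1 q1 : R) : p - q - (p1 - q1) = p - p1 - (q - q1) by ring.
  have swap : x + h *: w + h *: v = x + h *: v + h *: w by rewrite addrAC.
  by apply: etrans (esym Ey) (etrans _ Ez); rewrite swap; exact: alg.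
have [_ [/= yb _]] := rB _ yB; have [_ [_ /= zb]] := rB _ zB.
rewrite -Eyz in zb.
have tri (a b p : R) : `|a - b| <= `|a - p| + `|b - p|.
  by rewrite (distrC b); exact: ler_distD.
apply: le_trans (tri _ _ ('D_w ('D_v f) y)) _; rewrite (splitr e).
exact: lerD (ltW yb) (ltW zb).
Qed.

End Schwarz.

Lemma pd_comm (R : realType) (n : nat) (U : set 'rV[R]_n)
    (f : 'rV[R]_n -> R) i j :
  open U -> smooth_on U f -> {in U, pd i (pd j f) =1 pd j (pd i f)}.
Proof.
move=> U_open sf x /[!inE] Ux; have Unear := open_nbhs_nbhs (conj U_open Ux).
apply: derive_comm.
- apply: filterS Unear => y Uy.
  by split; apply: (smooth_pderivable sf).
- apply: filterS Unear => y Uy.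
  by split; [apply: (smooth_pderivable (smooth_pd j sf))
            |apply: (smooth_pderivable (smooth_pd i sf))].
- have [/(_ x Ux)] := smooth_pd i (smooth_pd j sf) 0%N; by [].
- have [/(_ x Ux)] := smooth_pd j (smooth_pd i sf) 0%N; by [].
Qed.

(** * Linear algebra at one point: from the cyclic identity to the form of C *)

Section Contraction.
Variables (F : realFieldType) (n : nat) (G I : 'M[F]_n).
Hypotheses (G_sym : forall i j, G i j = G j i) (I_sym : forall i j, I i j = I j i).
Hypothesis mulGI : G *m I = 1%:M.
Implicit Types (u v : 'I_n -> F) (i j k l m : 'I_n).

Lemma sum_delta v j : \sum_i (i == j)%:R * v i = v j.
Proof.
rewrite (bigD1 j) //= eqxx mul1r big1 ?addr0 // => i /negbTE ->.
by rewrite mul0r.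
Qed.

Definition trace (f : 'I_n -> 'I_n -> F) := \sum_i \sum_m I i m * f i m.

Lemma trace_sym f : trace (fun i m => f m i) = trace f.
Proof.
rewrite /trace exchange_big; apply: eq_bigr => m _; apply: eq_bigr => i _.
by rewrite I_sym.
Qed.

Lemma eq_trace f h : f =2 h -> trace f = trace h.
Proof.
by move=> fh; apply: eq_bigr => i _; apply: eq_bigr => m _; rewrite fh.
Qed.

Lemma traceD f h : trace (fun i m => f i m + h i m) = trace f + trace h.
Proof.
rewrite /trace -big_split; apply: eq_bigr => i _; rewrite -big_split.
by apply: eq_bigr => m _; rewrite mulrDr.
Qed.

Lemma traceZ c f : trace (fun i m => c * f i m) = c * trace f.
Proof.
rewrite /trace mulr_sumr; apply: eq_bigr => i _; rewrite mulr_sumr.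
by apply: eq_bigr => m _; rewrite mulrCA.
Qed.

Lemma traceZr c f : trace (fun i m => f i m * c) = trace f * c.
Proof. by rewrite mulrC -traceZ; apply: eq_trace => i m; rewrite mulrC. Qed.

Lemma traceN f : trace (fun i m => - f i m) = - trace f.
Proof.
by rewrite -mulN1r -traceZ; apply: eq_trace => i m; rewrite mulN1r.
Qed.

Lemma sumGI j i : \sum_m G j m * I m i = (i == j)%:R.
Proof. by have /matrixP/(_ j i) := mulGI; rewrite !mxE eq_sym. Qed.

Lemma traceG v j : trace (fun i m => G j m * v i) = v j.
Proof.
rewrite -(sum_delta v j); apply: eq_bigr => i _.
rewrite -sumGI mulr_suml; apply: eq_bigr => m _.
by rewrite (I_sym i m); ring.
Qed.

Lemma traceGl v j : trace (fun i m => G i j * v m) = v j.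
Proof.
by rewrite -[RHS]traceG -trace_sym; apply: eq_trace => i m; rewrite G_sym.
Qed.

Lemma traceGG : trace (fun i m => G i m) = n%:R.
Proof.
rewrite -[in RHS](card_ord n) -sumr_const; apply: eq_bigr => i _.
have -> : 1 = \sum_m G i m * I m i by rewrite sumGI eqxx.
by apply: eq_bigr => m _; rewrite mulrC I_sym.
Qed.

Variable a : 'I_n -> F.

Definition raised k := \sum_p I k p * a p.
Definition norm2 := \sum_k raised k * a k.

Lemma trace_raised v : trace (fun i m => a i * v m) = \sum_m raised m * v m.
Proof.
rewrite -trace_sym; apply: eq_bigr => i _; rewrite mulr_suml.
by apply: eq_bigr => m _; rewrite mulrA.
Qed.

Lemma sum_raisedG j : \sum_i raised i * G i j = a j.
Proof.
rewrite -trace_raised -[RHS]traceG; apply: eq_trace => i m.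
by rewrite mulrC G_sym.
Qed.

Variables (C : 'I_n -> 'I_n -> 'I_n -> 'I_n -> F) (T : 'I_n -> 'I_n -> 'I_n -> F).
Hypothesis C_antil : forall j k l m, C j k l m = - C k j l m.
Hypothesis C_antir : forall j k l m, C j k l m = - C j k m l.
Hypothesis C_cyclic : forall j k l m, C j k l m + C k l j m + C l j k m = 0.
Hypothesis C_tracefree : forall k l, trace (fun i m => C i k l m) = 0.
Hypothesis T_anti : forall j k l, T j k l = - T k j l.
(** The second Bianchi identity of the Weyl tensor at one point, with nabla C already replaced by a
    C. [T] stands for the antisymmetrized covariant derivative of the Schouten tensor, that is the
    Cotton tensor up to normalization. *)
Hypothesis aC_cyclic : forall i j k l m,
  a i * C j k l m + a j * C k i l m + a k * C i j l m =
  G j m * T i k l + G k m * T j i l + G i m * T k j l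
  + G k l * T i j m + G j l * T k i m + G i l * T j k m.
Hypothesis n_ge5 : (5 <= n)%N.
Hypothesis a2_neq0 : norm2 != 0.

(** The octahedron argument: the four cyclic identities, one for each starting index, are brought to
    common representatives by the two antisymmetries and combined linearly. It is applied later to
    the Riemann tensor as well. *)
Lemma C_pair j k l m : C j k l m = C l m j k.
Proof.
have e1 := C_cyclic j k l m; have e2 := C_cyclic k l m j.
have e3 := C_cyclic l m j k; have e4 := C_cyclic m j k l.
rewrite (C_antir k l m j) (C_antir l m k j) (C_antil m k l j) in e2.
rewrite (C_antil m j l k) (C_antir j m l k) in e3.
rewrite (C_antil j l m k) (C_antir l j m k) in e3.
rewrite (C_antil m j k l) (C_antir j k m l) (C_antir k m j l) in e4.
by lra.
Qed.

Let D j k l := \sum_m raised m * C j k l m.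
Let E i l := \sum_j \sum_k raised j * raised k / norm2 * C i j k l.
Let N : F := n%:R.
Let N_ge5 : 5%:R <= N. Proof. by rewrite ler_nat. Qed.

(* Index positions in names: C24 contracts the 2nd and 4th slots of C. *)
Lemma trace_C24 i k : trace (fun l m => C k l i m) = 0.
Proof.
rewrite -[RHS]oppr0 -(C_tracefree k i) -traceN; apply: eq_trace => l m.
exact: C_antil.
Qed.

(* Contraction of aC_cyclic over i and m. *)
Lemma D_cotton_trace j k l :
  let t j := trace (fun i m => T i j m) in
  D j k l = (3 - N) * T j k l + G k l * t j - G j l * t k.
Proof.
move=> t; have :
  trace (fun i m => a i * C j k l m + a j * C k i l m + a k * C i j l m)
  = trace (fun i m => G j m * T i k l + G k m * T j i l + G i m * T k j l
  + G k l * T i j m + G j l * T k i m + G i l * T j k m).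
  by apply: eq_trace => i m; exact: aC_cyclic.
rewrite !traceD !traceZ C_tracefree trace_C24 trace_raised.
(* Origin of 3 - N: three of the metric terms return T_jkl, while G_im T_kjl contributes the full
   trace N with the opposite sign. *)
rewrite !traceG traceZr traceGG traceGl.
have -> : trace (fun i m => T k i m) = - t k.
  by rewrite -traceN; apply: eq_trace => i m; exact: T_anti.
rewrite -/(D j k l) -/(t j) (T_anti k j) => H; rewrite -/N in H.
have {}H : D j k l = T j k l + T j k l + N * - T j k l + G k l * t j + G j l * - t k
   + T j k l by rewrite -H; ring.
by rewrite H; ring.
Qed.

(** Contracting [D_cotton_trace] over k and l turns the left side into alpha^m times a trace of C,
    hence 0. On the right, t_j collects N - 3 from T, N from the trace of G and -1 from the last
    term, so (2N - 4) t_j = 0. *)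
Lemma cotton_tracefree j : trace (fun i m => T i j m) = 0.
Proof.
set t := fun j => trace (fun i m => T i j m); rewrite -/(t j).
have : trace (fun k l => D j k l) =
    trace (fun k l => (3 - N) * T j k l + G k l * t j - G j l * t k).
  by apply: eq_trace => k l; exact: D_cotton_trace.
rewrite !traceD traceN traceZ traceZr traceGG traceG.
have -> : trace (fun i m => T j i m) = - t j.
  by rewrite -traceN; apply: eq_trace => i m; exact: T_anti.
have -> : trace (fun k l => D j k l) = 0.
  rewrite /trace; under eq_bigr => k _ do under eq_bigr => l _ do rewrite mulr_sumr.
  under eq_bigr => k _ do rewrite exchange_big.
  rewrite exchange_big big1 //= => m _.
  transitivity (raised m * trace (fun k l => C j k l m)); last first.
    have -> : trace (fun k l => C j k l m) = 0; last by rewrite mulr0.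
    rewrite -[RHS]oppr0 -[in RHS](trace_C24 m j) -traceN; apply: eq_trace => k l.
    exact: C_antir.
  rewrite -traceZ; apply: eq_bigr => k _; apply: eq_bigr => l _; ring.
rewrite -/N => H.
have {}H : (2 * N - 4) * t j = 0 by rewrite H; ring.
move/eqP: H; rewrite mulf_eq0 => /orP[/eqP|/eqP//].
by have := N_ge5; lra.
Qed.

Lemma D_cotton j k l : D j k l = (3 - N) * T j k l.
Proof. by rewrite D_cotton_trace !cotton_tracefree; ring. Qed.

Lemma raised_C23 i l : norm2 * E i l = \sum_j raised j * \sum_k raised k * C i j k l.
Proof.
rewrite /E mulr_sumr; apply: eq_bigr => j _; rewrite !mulr_sumr.
by apply: eq_bigr => k _; field.
Qed.

Lemma raised_D2 i l : \sum_j raised j * D i j l = - norm2 * E i l.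
Proof.
rewrite mulNr raised_C23 -sumrN; apply: eq_bigr => j _; rewrite -mulrN -sumrN.
congr (_ * _); apply: eq_bigr => k _.
by rewrite (C_antir i j l); ring.
Qed.

Lemma raised_D1 i l : \sum_j raised j * D j i l = norm2 * E i l.
Proof.
rewrite -[RHS]opprK -mulNr -raised_D2 -sumrN; apply: eq_bigr => j _.
rewrite -mulrN -sumrN; congr (_ * _); apply: eq_bigr => k _.
by rewrite (C_antil i j l); ring.
Qed.

Lemma raised_antisym (S : 'I_n -> 'I_n -> F) : (forall i j, S i j = - S j i) ->
  \sum_i raised i * \sum_j raised j * S i j = 0.
Proof.
move=> aS; set X := LHS; suff : X = - X by lra.
rewrite {1}/X; under eq_bigr => i _ do rewrite mulr_sumr.
rewrite exchange_big -sumrN; apply: eq_bigr => j _; rewrite mulr_sumr -sumrN.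
by apply: eq_bigr => i _; rewrite (aS i); ring.
Qed.

Lemma raised_D3 j k : \sum_l raised l * D j k l = 0.
Proof. by apply: raised_antisym => l m; exact: C_antir. Qed.

(** Pair symmetry of C, after exchanging the two contracted copies of alpha. *)
Lemma E_sym i l : E i l = E l i.
Proof.
apply: (mulfI a2_neq0); rewrite !raised_C23.
under eq_bigr => j _ do rewrite mulr_sumr; rewrite exchange_big /=.
apply: eq_bigr => j _; rewrite mulr_sumr; apply: eq_bigr => k _.
by rewrite C_pair (C_antil j l) (C_antir l j i k); ring.
Qed.

(** The third copy of alpha meets one already contracted into the antisymmetric last pair of C. *)
Lemma raised_E l : \sum_m raised m * E l m = 0.
Proof.
apply: (mulfI a2_neq0); rewrite mulr0 mulr_sumr.
under eq_bigr => m _ do rewrite mulrCA raised_C23 mulr_sumr.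
rewrite exchange_big /= big1 // => j _.
transitivity (raised j * \sum_m raised m * \sum_k raised k * C l j k m).
  by rewrite mulr_sumr; apply: eq_bigr => m _; rewrite mulrCA.
by rewrite raised_antisym ?mulr0// => p q; exact: C_antir.
Qed.

Let sum_raisedZ (c : F) v : \sum_m raised m * (c * v m) = c * \sum_m raised m * v m.
Proof. by rewrite mulr_sumr; apply: eq_bigr => m _; rewrite mulrCA. Qed.

Let sum_raisedD u v : \sum_m raised m * (u m + v m) =
  \sum_m raised m * u m + \sum_m raised m * v m.
Proof. by rewrite -big_split; apply: eq_bigr => m _; rewrite mulrDr. Qed.

(* Contraction of aC_cyclic with alpha^i. *)
Lemma C_weylE j k l m :
  (N - 3) * (norm2 * C j k l m + a j * D l m k - a k * D l m j) =
  - (norm2 * G j m * E k l - norm2 * G k m * E j l + a m * D k j l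
     + norm2 * G k l * E j m - norm2 * G j l * E k m + a l * D j k m).
Proof.
have n3 : N - 3 != 0 by have := N_ge5; lra.
have TD p q r : T p q r = - (N - 3)^-1 * D p q r.
  by rewrite D_cotton; field.
(* The factors that do not depend on the summation index are moved to the left, so that
   [sum_raisedZ] can pull them out. *)
have : \sum_i raised i * (C j k l m * a i + a j * C k i l m + a k * C i j l m) =
  \sum_i raised i * (G j m * T i k l + G k m * T j i l + T k j l * G i m
  + G k l * T i j m + G j l * T k i m + T j k m * G i l).
  apply: eq_bigr => i _; congr (_ * _).
  by rewrite (mulrC (C _ _ _ _)) (mulrC (T k j l)) (mulrC (T j k m)).
rewrite !sum_raisedD !sum_raisedZ !sum_raisedG -/norm2.
(* Through D, contracting T with alpha in its first or second slot gives E up to sign; this is where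
   T leaves the identity. *)
have TD1 p q : \sum_i raised i * T i p q = - (N - 3)^-1 * (norm2 * E p q).
  by rewrite -raised_D1 -sum_raisedZ; apply: eq_bigr => i _; rewrite TD.
have TD2 p q : \sum_i raised i * T p i q = (N - 3)^-1 * (norm2 * E p q).
  rewrite -mulrNN -mulNr -raised_D2 -sum_raisedZ.
  by apply: eq_bigr => i _; rewrite TD.
rewrite !TD1 !TD2 !TD.
have -> : \sum_i raised i * C k i l m = D l m k.
  by apply: eq_bigr => i _; rewrite C_pair.
have -> : \sum_i raised i * C i j l m = - D l m j.
  rewrite -sumrN; apply: eq_bigr => i _.
  by rewrite C_pair (C_antir l m i j); ring.
move=> H.
have {}H : norm2 * C j k l m + a j * D l m k - a k * D l m j =
  G j m * (- (N - 3)^-1 * (norm2 * E k l)) + G k m * ((N - 3)^-1 * (norm2 * E j l)) +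
    - (N - 3)^-1 * D k j l * a m + G k l * (- (N - 3)^-1 * (norm2 * E j m)) +
    G j l * ((N - 3)^-1 * (norm2 * E k m)) + - (N - 3)^-1 * D j k m * a l.
  by rewrite -H; ring.
by rewrite H; field.
Qed.

(* Contraction of C_weylE with alpha^m. *)
Lemma D_weylE j k l : D j k l = a j * E k l - a k * E j l.
Proof.
(* Contracting with alpha^m makes D_kjl = - D_jkl appear on the right, lowering the coefficient N -
   3 of D by one; the E terms lose one in the same way. In dimension 4 the relation would read 0 =
   0. *)
have n4 : (N - 4) * norm2 != 0.
  by rewrite mulf_neq0//; have := N_ge5; lra.
have uG i : \sum_m raised m * G i m = a i.
  by rewrite -[RHS]sum_raisedG; apply: eq_bigr => m _; rewrite G_sym.
have Danti p q r : D p q r = - D q p r.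
  rewrite -sumrN; apply: eq_bigr => m _.
  by rewrite (C_antil p) mulrN.
have : \sum_m raised m * ((N - 3) * (norm2 * C j k l m + a j * D l m k
    + - a k * D l m j)) = \sum_m raised m * (- 1 * (norm2 * E k l * G j m
    (* Signs are absorbed into scalar factors, so that the contraction distributes by [sum_raisedD]
       and [sum_raisedZ] alone. *)
    + - (norm2 * E j l) * G k m + D k j l * a m + norm2 * G k l * E j m
     + - (norm2 * G j l) * E k m + a l * D j k m)).
  by apply: eq_bigr => m _; congr (_ * _); have := C_weylE j k l m; lra.
rewrite !(sum_raisedZ, sum_raisedD) -/norm2 !raised_D2 !raised_D3.
rewrite !raised_E !uG -/(D j k l).
rewrite (Danti k j) (E_sym l k) (E_sym l j) => H.
by apply: (mulfI n4); lra.
Qed.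

(** With D eliminated, each a a E term occurs N - 3 times from the left side of [C_weylE] and once
    from the right, which is the coefficient N - 2. *)
Lemma curvature_decomposition j k l m :
  C j k l m = (N - 3)^-1 *
      (G m k * E j l - G m j * E k l + G j l * E k m - G k l * E j m)
    - (N - 2) / (N - 3) *
      (a k * a m / norm2 * E j l - a j * a m / norm2 * E k l
       + a j * a l / norm2 * E k m - a k * a l / norm2 * E j m).
Proof.
have n3 : N - 3 != 0 by have := N_ge5; lra.
have H := C_weylE j k l m; apply: (mulfI a2_neq0); apply: (mulfI n3).
rewrite !D_weylE in H; rewrite (G_sym m k) (G_sym m j).
rewrite (E_sym m k) (E_sym l k) (E_sym m j) (E_sym l j) in H.
have {}H : (N - 3) * (norm2 * C j k l m) =
 - (norm2 * G j m * E k l - norm2 * G k m * E j l +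
         a m * (a k * E j l - a j * E k l) + norm2 * G k l * E j m -
         norm2 * G j l * E k m + a l * (a j * E k m - a k * E j m))
  - (N - 3) * (a j * (a l * E k m - a m * E k l)
               - a k * (a l * E j m - a m * E j l)).
  by rewrite -H; ring.
by rewrite H; field; rewrite n3 a2_neq0.
Qed.

End Contraction.

(** * Matrix identities behind the curvature symmetries and the Bianchi identity *)

Section MatrixIdentities.
Variables (R : realFieldType) (n : nat).
Implicit Types (A B C G : 'M[R]_n).

(** Together with [oppE] this opens sums and opposites but no products: entries of matrix products
    stay atoms for [ring] and [lra], and [expandE] brings the products to a common form. *)
Let addE A B l m : (A + B) l m = A l m + B l m. Proof. by rewrite mxE. Qed.
Let oppE A l m : (- A) l m = - A l m. Proof. by rewrite mxE. Qed.
Let expandE := (mulmxDl, mulmxDr, mulmxBl, mulmxBr, mulNmx, mulmxN, mulmxA).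

(** The hypothesis equates the two orders of second derivatives of g, computed from d_a g = G_a g +
    g G_a^T. The mixed terms G_1 g G_2^T and G_2 g G_1^T cancel, leaving R_12 g + g R_12^T = 0. *)
Lemma curvature_metric_tr (g G1 G2 d12 d21 : 'M[R]_n) : g^T = g ->
  d12 *m g + G2 *m (G1 *m g + g *m G1^T)
    + ((G1 *m g + g *m G1^T) *m G2^T + g *m d12^T) =
  d21 *m g + G1 *m (G2 *m g + g *m G2^T)
    + ((G2 *m g + g *m G2^T) *m G1^T + g *m d21^T) ->
  ((d21 - d12 + G1 *m G2 - G2 *m G1) *m g)^T =
  - ((d21 - d12 + G1 *m G2 - G2 *m G1) *m g).
Proof.
move=> gT H; rewrite trmx_mul gT.
have -> : (d21 - d12 + G1 *m G2 - G2 *m G1)^T =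
    d21^T - d12^T + G2^T *m G1^T - G1^T *m G2^T.
  by rewrite -!trmx_mul; apply/matrixP => l m; rewrite !(mxE, addE, oppE).
rewrite !expandE in H *.
apply/matrixP => l m; move/matrixP: H => /(_ l m); rewrite !(addE, oppE) => H.
by lra.
Qed.

(* G_a, d_ab and h_c stand for the connection matrices, their first derivatives
   d_a G_b, and the second derivatives d_a d_b G_c, h_c' being d_b d_a G_c. *)
Lemma Bianchi_jacobi
    (G1 G2 G3 d12 d13 d21 d23 d31 d32 h1 h2 h3 h1' h2' h3' : 'M[R]_n) :
  h1' = h1 -> h2' = h2 -> h3' = h3 ->
  let R12 := d21 - d12 + G1 *m G2 - G2 *m G1 in
  let R23 := d32 - d23 + G2 *m G3 - G3 *m G2 in
  let R31 := d13 - d31 + G3 *m G1 - G1 *m G3 in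
  (h2 - h3 + (d12 *m G3 + G2 *m d13) - (d13 *m G2 + G3 *m d12)
    + R23 *m G1 - G1 *m R23)
  + (h3' - h1 + (d23 *m G1 + G3 *m d21) - (d21 *m G3 + G1 *m d23)
    + R31 *m G2 - G2 *m R31)
  + (h1' - h2' + (d31 *m G2 + G1 *m d32) - (d32 *m G1 + G2 *m d31)
    + R12 *m G3 - G3 *m R12) = 0.
Proof.
move=> -> -> -> R12 R23 R31; rewrite /R12 /R23 /R31 !expandE.
by apply/matrixP => l m; rewrite !(addE, oppE) [RHS]mxE; ring.
Qed.

(** Differentiating the metric factor produces R0 g G^T, which cancels the connection term of the
    lowered index; a commutator with G remains. [u] and [v] stand for the connection terms of the
    other two indices. *)
Lemma covariant_derivative_low (g G R0 dR : 'M[R]_n) l m (u v : R) :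
  (dR *m g + R0 *m (G *m g + g *m G^T)) l m - u - v - (G *m (R0 *m g)) l m
    - ((R0 *m g) *m G^T) l m =
  ((dR + R0 *m G - G *m R0) *m g) l m - u - v.
Proof. by rewrite !expandE !(addE, oppE); ring. Qed.

Lemma mulmx_sum3_eq0 A B C G l m : A + B + C = 0 ->
  (A *m G) l m + (B *m G) l m + (C *m G) l m = 0.
Proof. by move=> H; rewrite -!addE -!mulmxDl H mul0mx mxE. Qed.

Lemma sum3_mul_eq0 (a b c w : 'I_n -> R) (u v t : R) :
  u = \sum_p a p * w p -> v = \sum_p b p * w p -> t = \sum_p c p * w p ->
  (forall p, a p + b p + c p = 0) -> u + v + t = 0.
Proof.
move=> -> -> -> abc; rewrite -!big_split big1 // => p _ /=.
by rewrite -!mulrDl abc mul0r.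
Qed.

Lemma cyclic_cancel (a b c a1 a2 b1 b2 c1 c2 : R) : a + b + c = 0 ->
  a1 = - b2 -> b1 = - c2 -> c1 = - a2 ->
  (a - a1 - a2) + (b - b1 - b2) + (c - c1 - c2) = 0.
Proof. by move=> abc -> -> ->; lra. Qed.

End MatrixIdentities.

(** * Smooth matrix-valued functions and their derivatives *)

Section MatrixFields.
Variables (R : realType) (n : nat) (U : set 'rV[R]_n).
Hypothesis U_open : open U.
Implicit Types (A B : 'rV[R]_n -> 'M[R]_n) (i j : 'I_n).

Definition pd_mx i A x : 'M[R]_n := \matrix_(a, b) pd i (fun y => A y a b) x.

Definition smooth_mx A := forall a b, smooth_on U (fun x => A x a b).

Lemma eq_on_smooth_mx A B : {in U, A =1 B} -> smooth_mx A -> smooth_mx B.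
Proof.
move=> AB sA a b; apply: (eq_on_smooth U_open) (sA a b) => x Ux.
by rewrite AB.
Qed.

Lemma smooth_pd_mx i A : smooth_mx A -> smooth_mx (pd_mx i A).
Proof.
move=> sA a b; apply: (eq_on_smooth U_open) (smooth_pd i (sA a b)) => x _.
by rewrite mxE.
Qed.

Lemma smooth_mxD A B : smooth_mx A -> smooth_mx B ->
  smooth_mx (fun x => A x + B x).
Proof.
move=> sA sB a b.
apply: (eq_on_smooth U_open) (smoothD U_open (sA a b) (sB a b)) => x _.
by rewrite mxE.
Qed.

Lemma smooth_mxB A B : smooth_mx A -> smooth_mx B ->
  smooth_mx (fun x => A x - B x).
Proof.
move=> sA sB a b.
apply: (eq_on_smooth U_open) (smoothB U_open (sA a b) (sB a b)) => x _.
by rewrite !mxE.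
Qed.

Lemma smooth_mulmx A B : smooth_mx A -> smooth_mx B ->
  smooth_mx (fun x => A x *m B x).
Proof.
move=> sA sB a b.
apply: (eq_on_smooth U_open (f := fun x => \sum_p A x a p * B x p b)).
  by move=> x _; rewrite mxE.
by apply: smooth_sum => // p; apply: smoothM.
Qed.

Lemma smooth_trmx A : smooth_mx A -> smooth_mx (fun x => (A x)^T).
Proof.
move=> sA a b; apply: (eq_on_smooth U_open) (sA b a) => x _.
by rewrite mxE.
Qed.

Lemma eq_on_pd_mx A B i : {in U, A =1 B} -> {in U, pd_mx i A =1 pd_mx i B}.
Proof.
move=> AB x Ux; apply/matrixP => a b; rewrite !mxE.
by apply: (eq_on_pd U_open) => // y Uy; rewrite AB.
Qed.

Lemma pd_mxD A B i : smooth_mx A -> smooth_mx B ->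
  {in U, pd_mx i (fun x => A x + B x) =1 fun x => pd_mx i A x + pd_mx i B x}.
Proof.
move=> sA sB x Ux; apply/matrixP => a b; rewrite !mxE.
rewrite -(pdD (U := U))//; try exact: smooth_pderivable.
by apply: (eq_on_pd U_open) Ux => y _; rewrite mxE.
Qed.

Lemma pd_mxB A B i : smooth_mx A -> smooth_mx B ->
  {in U, pd_mx i (fun x => A x - B x) =1 fun x => pd_mx i A x - pd_mx i B x}.
Proof.
move=> sA sB x Ux; apply/matrixP => a b; rewrite !mxE.
rewrite -(pdB (U := U))//; try exact: smooth_pderivable.
by apply: (eq_on_pd U_open) Ux => y _; rewrite !mxE.
Qed.

Lemma pd_mxM A B i : smooth_mx A -> smooth_mx B ->
  {in U, pd_mx i (fun x => A x *m B x) =1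
         fun x => pd_mx i A x *m B x + A x *m pd_mx i B x}.
Proof.
move=> sA sB x Ux; apply/matrixP => a b; rewrite !mxE.
transitivity (pd i (fun y => \sum_p A y a p * B y p b) x).
  by apply: (eq_on_pd U_open) Ux => y _; rewrite !mxE.
rewrite (pd_sum (U := U))//; last first.
  by move=> p; apply: smooth_pderivable; apply: smoothM.
rewrite -big_split; apply: eq_bigr => p _.
rewrite (pdM (U := U))//; try exact: smooth_pderivable.
by rewrite !mxE addrC mulrC.
Qed.

Lemma pd_mxT A i x : pd_mx i (fun y => (A y)^T) x = (pd_mx i A x)^T.
Proof.
apply/matrixP => a b; rewrite [LHS]mxE [RHS]mxE [RHS]mxE.
have -> // : (fun y => (A y)^T a b) = (fun y => A y b a).
by apply/funext => y; rewrite mxE.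
Qed.

Lemma pd_mx_comm A i j : smooth_mx A ->
  {in U, pd_mx i (pd_mx j A) =1 pd_mx j (pd_mx i A)}.
Proof.
move=> sA x Ux; apply/matrixP => a b; rewrite [LHS]mxE [RHS]mxE.
have E p : (fun y => pd_mx p A y a b) = pd p (fun y => A y a b).
  by apply/funext => y; rewrite mxE.
by rewrite (E j) (E i); exact: (pd_comm i j U_open (sA a b)).
Qed.

End MatrixFields.

(** * Symmetries of the Riemann tensor and its two Bianchi identities *)

Section Bianchi.
Variables (R : realType) (n : nat) (U : set 'rV[R]_n) (g : 'rV[R]_n -> 'M[R]_n).
Hypothesis U_open : open U.
Hypothesis g_smooth : smooth_mx U g.
Hypothesis g_sym : forall x, U x -> forall i j, g x i j = g x j i.
Hypothesis g_unit : {in U, forall x, g x \in unitmx}.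
Implicit Types (i j k l m p : 'I_n) (x : 'rV[R]_n).

Lemma smooth_ginv : smooth_mx U (ginv g).
Proof. exact: smooth_invmx. Qed.

Lemma ginv_sym x : U x -> forall i j, ginv g x i j = ginv g x j i.
Proof.
move=> Ux i j; rewrite /ginv -[in LHS](_ : (g x)^T = g x).
  by rewrite -trmx_inv mxE.
by apply/matrixP => a b; rewrite mxE g_sym.
Qed.

Lemma smooth_christoffel i j k : smooth_on U (christoffel g i j k).
Proof.
apply: smoothM => //; first exact: smooth_cst.
apply: smooth_sum => // m; apply: smoothM => //; first exact: smooth_ginv.
by apply: smoothB => //; [apply: smoothD => //|]; apply: smooth_pd.
Qed.

Lemma g_sym_near x : U x -> \forall y \near x, forall i j, g y i j = g y j i.
Proof. by move=> Ux; apply: filterS (open_nbhs_nbhs (conj U_open Ux)). Qed.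

Lemma christoffel_sym x i j k : U x -> christoffel g i j k x = christoffel g j i k x.
Proof.
by move=> Ux; apply: christoffel_torsion_free => //; exact: g_sym_near.
Qed.

(** Rows carry the lower index and columns the upper one, so the matrix acts on covectors: nabla_i v
    = d_i v - Gamma_i v. *)
Definition Gamma i x : 'M[R]_n := \matrix_(l, m) christoffel g i l m x.

Lemma smooth_Gamma i : smooth_mx U (Gamma i).
Proof.
move=> a b; apply: (eq_on_smooth U_open) (smooth_christoffel i a b) => x _.
by rewrite mxE.
Qed.

Lemma pd_mx_metric i :
  {in U, pd_mx i g =1
         fun x => Gamma i x *m g x + g x *m (Gamma i x)^T}.
Proof.
move=> x /[!inE] Ux; apply/matrixP => j k; rewrite !mxE.
have := christoffel_metric (g_sym_near Ux) (g_unit (mem_set Ux)) i j k.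
rewrite /nabla2 => H.
under eq_bigr => p _ do rewrite mxE.
under [X in _ = _ + X]eq_bigr => p _ do rewrite !mxE mulrC.
by lra.
Qed.

Definition Riem j k x : 'M[R]_n := \matrix_(l, m) riemann g j k l m x.

(** The commutator of d_j - Gamma_j and d_k - Gamma_k, which explains the order of the indices in
    the derivative terms. *)
Lemma RiemE j k : {in U, Riem j k =1 fun x =>
  pd_mx k (Gamma j) x - pd_mx j (Gamma k) x
  + Gamma j x *m Gamma k x - Gamma k x *m Gamma j x}.
Proof.
move=> x /[!inE] Ux; apply/matrixP => l m; rewrite !mxE.
rewrite (riemannE (x := x)).
- have E a b : pd a (fun y => Gamma b y l m) x = pd a (christoffel g b l m) x.
    by congr (pd a _ x); apply/funext => y; rewrite mxE.
  rewrite !E; congr (_ + _ - _); apply: eq_bigr => p _; by rewrite !mxE.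
- by move=> *; exact: christoffel_sym.
- by move=> *; apply: (smooth_pderivable (smooth_christoffel _ _ _)).
Qed.

Lemma smooth_Riem j k : smooth_mx U (Riem j k).
Proof.
have s := smooth_Gamma.
apply: (eq_on_smooth_mx U_open) (_ : smooth_mx U (fun x =>
  pd_mx k (Gamma j) x - pd_mx j (Gamma k) x
  + Gamma j x *m Gamma k x - Gamma k x *m Gamma j x)).
  by move=> x Ux; rewrite RiemE.
apply: smooth_mxB => //; last exact: smooth_mulmx.
apply: smooth_mxD => //; last exact: smooth_mulmx.
by apply: smooth_mxB => //; apply: smooth_pd_mx.
Qed.

Lemma riemann_anti j k l m x : riemann g j k l m x = - riemann g k j l m x.
Proof. exact: esym (opprB _ _). Qed.

Lemma Riem_anti j k x : Riem j k x = - Riem k j x.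
Proof. by apply/matrixP => l m; rewrite !mxE; exact: riemann_anti. Qed.

Definition Riem_low j k x := Riem j k x *m g x.

Lemma smooth_Riem_low j k : smooth_mx U (Riem_low j k).
Proof. by apply: smooth_mulmx => //; exact: smooth_Riem. Qed.

Lemma Riem_low_anti j k x : Riem_low j k x = - Riem_low k j x.
Proof. by rewrite /Riem_low Riem_anti mulNmx. Qed.

Lemma pd_mx2_metric i j : {in U, pd_mx i (pd_mx j g) =1 fun x =>
   pd_mx i (Gamma j) x *m g x
   + Gamma j x *m (Gamma i x *m g x + g x *m (Gamma i x)^T)
   + ((Gamma i x *m g x + g x *m (Gamma i x)^T) *m (Gamma j x)^T
      + g x *m (pd_mx i (Gamma j) x)^T)}.
Proof.
move=> x Ux; have s := smooth_Gamma.
rewrite (eq_on_pd_mx U_open i (pd_mx_metric j) Ux).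
rewrite (pd_mxD U_open)//; try (apply: smooth_mulmx => //; exact: smooth_trmx).
rewrite !(pd_mxM U_open)//; last exact: smooth_trmx.
by rewrite pd_mxT -(pd_mx_metric i Ux).
Qed.

(** The integrability condition d_j d_k g = d_k d_j g of the equation nabla g = 0. *)
Lemma Riem_low_tr j k : {in U, forall x, (Riem_low j k x)^T = - Riem_low j k x}.
Proof.
move=> x Ux.
have gT : (g x)^T = g x.
  by apply/matrixP => a b; rewrite mxE g_sym//; exact: set_mem.
have H := etrans (esym (pd_mx2_metric j k Ux))
  (etrans (pd_mx_comm U_open j k g_smooth Ux) (pd_mx2_metric k j Ux)).
cbv beta in H.
rewrite /Riem_low (RiemE j k Ux); exact: curvature_metric_tr gT H.
Qed.

(** By zero torsion, d_c Gamma_ab is symmetric in a and b, and row c of Gamma_a Gamma_b is symmetric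
    in a and c. The derivative terms and the quadratic terms then cancel in pairs separately. *)
Lemma riemann_cyclic j k l m x : U x ->
  riemann g j k l m x + riemann g k l j m x + riemann g l j k m x = 0.
Proof.
move=> Ux.
have E a b c : riemann g a b c m x =
  pd b (christoffel g a c m) x - pd a (christoffel g b c m) x
  + (Gamma a x *m Gamma b x) c m - (Gamma b x *m Gamma a x) c m.
  rewrite (riemannE (x := x)).
  - by congr (_ + _ - _); rewrite mxE; apply: eq_bigr => p _; rewrite !mxE.
  - by move=> *; exact: christoffel_sym.
  - by move=> *; apply: (smooth_pderivable (smooth_christoffel _ _ _)).
have S c a b : pd c (christoffel g a b m) x = pd c (christoffel g b a m) x.
  apply: (eq_on_pd U_open); last by rewrite inE.
  by move=> y /[!inE] Uy; exact: christoffel_sym.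
have M a b c : (Gamma a x *m Gamma b x) c m = (Gamma c x *m Gamma b x) a m.
  rewrite !mxE; apply: eq_bigr => p _.
  by rewrite !mxE christoffel_sym.
have alg (P Q : 'I_n -> 'I_n -> 'I_n -> R) :
    (forall c a b, P c a b = P c b a) -> (forall a b c, Q a b c = Q c b a) ->
    P k j l - P j k l + Q j k l - Q k j l + (P l k j - P k l j + Q k l j - Q l k j)
    + (P j l k - P l j k + Q l j k - Q j l k) = 0.
  move=> SP SQ; rewrite (SP k l) (SP j l) (SP l k) (SQ j k l) (SQ k j l) (SQ j l k).
  by ring.
rewrite (E j k l) (E k l j) (E l j k).
exact: (alg (fun c a b => pd c (christoffel g a b m) x)
            (fun a b c => (Gamma a x *m Gamma b x) c m)).
Qed.

Lemma Riem_low_cyclic j k l m x : U x ->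
  Riem_low j k x l m + Riem_low k l x j m + Riem_low l j x k m = 0.
Proof.
move=> Ux.
have E a b c : Riem_low a b x c m = \sum_p riemann g a b c p x * g x p m.
  by rewrite mxE; apply: eq_bigr => p _; congr (_ * _); rewrite mxE.
apply: sum3_mul_eq0 (E j k l) (E k l j) (E l j k) _ => p.
exact: riemann_cyclic.
Qed.

(** The curvature is treated as a matrix-valued two-form: the connection acts on the matrix indices
    and not on j and k. The cyclic sum of this expression is the exterior covariant derivative. *)
Definition nabla_curvature i j k x :=
  pd_mx i (Riem j k) x + Riem j k x *m Gamma i x - Gamma i x *m Riem j k x.

Lemma nabla4_Riem_low i j k l m x : U x ->
  nabla4 g (fun j k l m x => Riem_low j k x l m) i j k l m x =
  (nabla_curvature i j k x *m g x) l m
  - \sum_p christoffel g i j p x * Riem_low p k x l m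
  - \sum_p christoffel g i k p x * Riem_low j p x l m.
Proof.
move=> Ux; rewrite /nabla4.
have -> : \sum_p christoffel g i l p x * Riem_low j k x p m =
    (Gamma i x *m Riem_low j k x) l m.
  by rewrite mxE; apply: eq_bigr => p _; congr (_ * _); rewrite mxE.
have -> : \sum_p christoffel g i m p x * Riem_low j k x l p =
    (Riem_low j k x *m (Gamma i x)^T) l m.
  rewrite mxE; apply: eq_bigr => p _; rewrite mulrC; congr (_ * _).
  by rewrite mxE mxE.
have -> : pd i (fun y => Riem_low j k y l m) x = pd_mx i (Riem_low j k) x l m.
  by rewrite mxE.
have iUx := mem_set Ux.
have -> : pd_mx i (Riem_low j k) x = pd_mx i (Riem j k) x *m g x
    + Riem j k x *m (Gamma i x *m g x + g x *m (Gamma i x)^T).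
  rewrite -(pd_mx_metric i iUx).
  exact: (pd_mxM U_open i (smooth_Riem j k) g_smooth iUx).
exact: covariant_derivative_low.
Qed.

(** Second derivatives of Gamma cancel by Schwarz, the products of Gamma with its first derivatives
    cancel pairwise, and the cubic terms form the Jacobi identity. *)
Lemma nabla_curvature_cyclic i j k : {in U, forall x,
  nabla_curvature i j k x + nabla_curvature j k i x + nabla_curvature k i j x = 0}.
Proof.
move=> x Ux; have s := smooth_Gamma.
have E a b c : pd_mx a (Riem b c) x =
  pd_mx a (pd_mx c (Gamma b)) x - pd_mx a (pd_mx b (Gamma c)) x
  + (pd_mx a (Gamma b) x *m Gamma c x + Gamma b x *m pd_mx a (Gamma c) x)
  - (pd_mx a (Gamma c) x *m Gamma b x + Gamma c x *m pd_mx a (Gamma b) x).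
  rewrite (eq_on_pd_mx U_open a (RiemE b c) Ux).
  have s1 p q : smooth_mx U (pd_mx p (Gamma q)) by exact: smooth_pd_mx.
  have s2 p q : smooth_mx U (fun x => Gamma p x *m Gamma q x).
    exact: smooth_mulmx.
  have s3 := smooth_mxB U_open (s1 c b) (s1 b c).
  rewrite (pd_mxB U_open a (smooth_mxD U_open s3 (s2 b c)) (s2 c b) Ux).
  rewrite (pd_mxD U_open a s3 (s2 b c) Ux) (pd_mxB U_open a (s1 c b) (s1 b c) Ux).
  by rewrite (pd_mxM U_open a (s b) (s c) Ux) (pd_mxM U_open a (s c) (s b) Ux).
rewrite /nabla_curvature (E i j k) (E j k i) (E k i j).
rewrite (RiemE j k Ux) (RiemE k i Ux) (RiemE i j Ux).
have comm a b c := pd_mx_comm U_open a b (s c) Ux.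
exact: (Bianchi_jacobi (Gamma i x) (Gamma j x) (Gamma k x) _ _ _ _ _ _
          (comm k j i) (comm k i j) (comm j i k)).
Qed.

(** The connection terms on the form indices, absent from [nabla_curvature], cancel in the cyclic
    sum because the Christoffel symbols are symmetric and R_jk is antisymmetric. *)
Lemma nabla4_Riem_low_cyclic i j k l m x : U x ->
  let N := nabla4 g (fun j k l m x => Riem_low j k x l m) in
  N i j k l m x + N j k i l m x + N k i j l m x = 0.
Proof.
move=> Ux N; rewrite /N !nabla4_Riem_low//.
have H : (nabla_curvature i j k x *m g x) l m + (nabla_curvature j k i x *m g x) l m
    + (nabla_curvature k i j x *m g x) l m = 0.
  exact: mulmx_sum3_eq0 (nabla_curvature_cyclic i j k (mem_set Ux)).
have T a b c : \sum_p christoffel g a b p x * Riem_low p c x l m =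
    - \sum_p christoffel g b a p x * Riem_low c p x l m.
  rewrite -sumrN; apply: eq_bigr => p _.
  by rewrite christoffel_sym// Riem_low_anti mxE mulrN.
exact: cyclic_cancel H (T i j k) (T j k i) (T k i j).
Qed.

End Bianchi.

(** * Algebraic symmetries and trace-freeness of the Weyl tensor *)

Section AlgebraicWeyl.
Variables (F : realFieldType) (n : nat) (G I : 'M[F]_n).
Hypotheses (G_sym : forall i j, G i j = G j i) (I_sym : forall i j, I i j = I j i).
Hypothesis mulGI : G *m I = 1%:M.
Hypothesis n_ge3 : (3 <= n)%N.
Variables (Rm : 'I_n -> 'I_n -> 'I_n -> 'I_n -> F) (S : 'I_n -> 'I_n -> F).
Implicit Types (j k l m : 'I_n).

(** With this order of indices the product has the opposite of its most common sign, whence C = R +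
    g /\ S. *)
Definition kulkarni_nomizu j k l m :=
  G j m * S k l - G k m * S j l + S j m * G k l - S k m * G j l.

(** Ricci tensor and scalar curvature are parameters, so that the formula serves both the traces of
    an abstract [Rm] and the curvature fields of a metric. *)
Definition schouten (rc : 'I_n -> 'I_n -> F) (s : F) k l :=
  (n%:R - 2)^-1 * rc k l - s / (2 * (n%:R - 1) * (n%:R - 2)) * G k l.

Hypothesis Rm_antil : forall j k l m, Rm j k l m = - Rm k j l m.
Hypothesis Rm_antir : forall j k l m, Rm j k l m = - Rm j k m l.
Hypothesis Rm_cyclic : forall j k l m, Rm j k l m + Rm k l j m + Rm l j k m = 0.

Definition ricci_of k l := - trace I (fun i m => Rm i k l m).

Lemma ricci_of_sym k l : ricci_of k l = ricci_of l k.
Proof.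
rewrite /ricci_of -[in LHS](trace_sym I_sym); congr (- _); apply: eq_trace => i m.
by rewrite (C_pair Rm_antil Rm_antir Rm_cyclic) Rm_antil Rm_antir opprK.
Qed.

Hypothesis S_schouten : forall k l, S k l = schouten ricci_of (trace I ricci_of) k l.

Lemma schouten_sym k l : S k l = S l k.
Proof. by rewrite !S_schouten /schouten ricci_of_sym G_sym. Qed.

Definition weyl_of j k l m := Rm j k l m + kulkarni_nomizu j k l m.

Lemma weyl_of_antil j k l m : weyl_of j k l m = - weyl_of k j l m.
Proof. by rewrite /weyl_of Rm_antil /kulkarni_nomizu; ring. Qed.

Lemma weyl_of_antir j k l m : weyl_of j k l m = - weyl_of j k m l.
Proof. by rewrite /weyl_of Rm_antir /kulkarni_nomizu; ring. Qed.

(** The product of two symmetric tensors satisfies the cyclic identity; the symmetry of S rests on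
    the pair symmetry of [Rm]. *)
Lemma weyl_of_cyclic j k l m :
  weyl_of j k l m + weyl_of k l j m + weyl_of l j k m = 0.
Proof.
have := Rm_cyclic j k l m; rewrite /weyl_of /kulkarni_nomizu.
rewrite (schouten_sym l k) (schouten_sym j l) (schouten_sym k j).
rewrite (G_sym l k) (G_sym j l) (G_sym k j) => /eqP.
rewrite addr_eq0 => /eqP H; rewrite -[X in _ + (X + _)]opprK -H.
by ring.
Qed.

Lemma trace_schouten : trace I S = trace I ricci_of / (2 * (n%:R - 1)).
Proof.
have n3 : (3 : F) <= n%:R by rewrite ler_nat.
have n1 : n%:R - 1 != 0 :> F by lra.
have n2 : n%:R - 2 != 0 :> F by lra.
have -> : trace I S = trace I (fun k l => (n%:R - 2)^-1 * ricci_of k l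
    + - (trace I ricci_of / (2 * (n%:R - 1) * (n%:R - 2))) * G k l).
  by apply: eq_trace => k l; rewrite S_schouten /schouten mulNr.
rewrite traceD !traceZ (traceGG I_sym mulGI).
by field; rewrite n1 n2.
Qed.

(** The trace of g /\ S is (n - 2) S + tr(S) g, and S is normalized so that this is the Ricci
    tensor, the opposite of the trace of [Rm]. *)
Lemma weyl_of_tracefree k l : trace I (fun i m => weyl_of i k l m) = 0.
Proof.
have n3 : (3 : F) <= n%:R by rewrite ler_nat.
have n1 : n%:R - 1 != 0 :> F by lra.
have n2 : n%:R - 2 != 0 :> F by lra.
rewrite /weyl_of /kulkarni_nomizu !traceD !traceN !traceZr.
rewrite (traceGG I_sym mulGI) trace_schouten.
have -> : trace I (fun i m => G k m * S i l) = S k l.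
  exact: (traceG I_sym mulGI (fun i => S i l)).
have -> : trace I (fun i m => S k m * G i l) = S k l.
  rewrite -[RHS](traceGl G_sym I_sym mulGI (fun m => S k m)).
  by apply: eq_trace => i m; rewrite mulrC.
have -> : trace I (fun i m => Rm i k l m) = - ricci_of k l by rewrite opprK.
rewrite S_schouten /schouten.
by field; rewrite n1 n2.
Qed.

End AlgebraicWeyl.

(** Lowers the last index of [weyl_mixed] term by term: [d1], [d2] are the Kronecker deltas, [e1],
    [e2] the mixed Ricci components, and [w] a column of the metric. *)
Lemma sum_weyl (F : fieldType) n (r d1 d2 e1 e2 w : 'I_n -> F) (c a b u v s K : F) :
  \sum_p (r p + c * (d1 p * a - d2 p * b + e1 p * u - e2 p * v)
     - s * ((d1 p * u - d2 p * v) / K)) * w p =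
  \sum_p r p * w p + c * ((\sum_p d1 p * w p) * a - (\sum_p d2 p * w p) * b
     + (\sum_p e1 p * w p) * u - (\sum_p e2 p * w p) * v)
   - s * (((\sum_p d1 p * w p) * u - (\sum_p d2 p * w p) * v) / K).
Proof.
transitivity (\sum_p (r p * w p + ((c * a - 0) * (d1 p * w p)
  + (- (c * b) * (d2 p * w p) + (c * u * (e1 p * w p) + (- (c * v) * (e2 p * w p)
  + (- (s * u / K) * (d1 p * w p) + s * v / K * (d2 p * w p)))))))).
  by apply: eq_bigr => p _; ring.
by rewrite !big_split -!mulr_sumr /=; ring.
Qed.

(** * Rules for the covariant derivative of fields with four indices *)

Section Covariant.
Variables (R : realType) (n : nat) (U : set 'rV[R]_n) (g : 'rV[R]_n -> 'M[R]_n).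
Hypothesis U_open : open U.
Implicit Types (T : 'I_n -> 'I_n -> 'I_n -> 'I_n -> 'rV[R]_n -> R)
  (i j k l m : 'I_n) (x : 'rV[R]_n).

Definition pderivable4 T := forall j k l m, pderivable U (T j k l m).

Lemma eq_on_nabla4 T T' i j k l m :
  (forall j k l m, {in U, T j k l m =1 T' j k l m}) ->
  {in U, nabla4 g T i j k l m =1 nabla4 g T' i j k l m}.
Proof.
move=> TT x Ux; rewrite /nabla4.
have sub4 (P P' A A' B B' C C' D D' : R) : P = P' -> A = A' -> B = B' ->
    C = C' -> D = D' -> P - A - B - C - D = P' - A' - B' - C' - D'.
  by move=> -> -> -> -> ->.
by apply: sub4; [exact: (eq_on_pd U_open i (TT j k l m) Ux)|..];
  apply: eq_bigr => p _; rewrite TT.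
Qed.

Lemma nabla4D T T' i j k l m : pderivable4 T -> pderivable4 T' ->
  {in U, nabla4 g (fun j k l m x => T j k l m x + T' j k l m x) i j k l m =1
    fun x => nabla4 g T i j k l m x + nabla4 g T' i j k l m x}.
Proof.
move=> dT dT' x Ux; rewrite /nabla4.
have sD (f u v : 'I_n -> R) :
    \sum_p f p * (u p + v p) = \sum_p f p * u p + \sum_p f p * v p.
  by rewrite -big_split; apply: eq_bigr => p _; rewrite mulrDr.
have alg (P P' A A' B B' C C' D D' : R) :
    P + P' - (A + A') - (B + B') - (C + C') - (D + D') =
    P - A - B - C - D + (P' - A' - B' - C' - D') by ring.
apply: etrans (alg _ _ _ _ _ _ _ _ _ _).
by congr (_ - _ - _ - _ - _); [exact: (pdD i (dT j k l m) (dT' j k l m) Ux)|..];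
  exact: sD.
Qed.

Lemma nabla4N T i j k l m : pderivable4 T ->
  {in U, nabla4 g (fun j k l m x => - T j k l m x) i j k l m =1
    fun x => - nabla4 g T i j k l m x}.
Proof.
move=> dT x Ux; rewrite /nabla4.
have sN (f u : 'I_n -> R) : \sum_p f p * (- u p) = - \sum_p f p * u p.
  by rewrite -sumrN; apply: eq_bigr => p _; rewrite mulrN.
have alg (P A B C D : R) :
    - P - - A - - B - - C - - D = - (P - A - B - C - D) by ring.
apply: etrans (alg _ _ _ _ _).
by congr (_ - _ - _ - _ - _); [exact: (pdN i (dT j k l m) Ux)|..]; exact: sN.
Qed.

(** Permuting slots merely permutes the connection terms. The two swaps reduce the four terms of g
    /\ S to the single product g_jm S_kl. *)
Lemma nabla4_swapl T i j k l m x :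
  nabla4 g (fun j k l m => T k j l m) i j k l m x = nabla4 g T i k j l m x.
Proof. by rewrite /nabla4; congr (_ - _ - _); exact: addrAC. Qed.

Lemma nabla4_swapr T i j k l m x :
  nabla4 g (fun j k l m => T j k m l) i j k l m x = nabla4 g T i j k m l x.
Proof. by rewrite /nabla4; exact: addrAC. Qed.

(** Leibniz rule: the derivative of g_jm and the connection terms on j and m assemble into nabla g,
    which vanishes. *)
Lemma nabla4_metric_prod (S : 'I_n -> 'I_n -> 'rV[R]_n -> R) i j k l m x :
  U x -> (forall a b, pderivable U (fun x => g x a b)) ->
  (forall a b, pderivable U (S a b)) ->
  nabla2 g (fun a b y => g y a b) i j m x = 0 ->
  nabla4 g (fun j k l m x => g x j m * S k l x) i j k l m x =
  g x j m * nabla2 g S i k l x.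
Proof.
move=> Ux dg dS; rewrite /nabla4 /nabla2.
have -> : pd i (fun y => g y j m * S k l y) x =
    g x j m * pd i (S k l) x + S k l x * pd i (fun y => g y j m) x.
  exact: (pdM i (dg j m) (dS k l) (mem_set Ux)).
have s1 (f u : 'I_n -> R) c : \sum_p f p * (u p * c) = (\sum_p f p * u p) * c.
  by rewrite mulr_suml; apply: eq_bigr => p _; rewrite mulrA.
have s2 (f u : 'I_n -> R) c : \sum_p f p * (c * u p) = c * (\sum_p f p * u p).
  by rewrite mulr_sumr; apply: eq_bigr => p _; rewrite mulrCA.
have -> : \sum_p christoffel g i j p x * (g x p m * S k l x) =
  (\sum_p christoffel g i j p x * g x p m) * S k l x by exact: s1.
have -> : \sum_p christoffel g i m p x * (g x j p * S k l x) =
  (\sum_p christoffel g i m p x * g x j p) * S k l x by exact: s1.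
have -> : \sum_p christoffel g i k p x * (g x j m * S p l x) =
  g x j m * (\sum_p christoffel g i k p x * S p l x) by exact: s2.
have -> : \sum_p christoffel g i l p x * (g x j m * S k p x) =
  g x j m * (\sum_p christoffel g i l p x * S k p x) by exact: s2.
have alg (G s P Q A B C D : R) : P - A - B = 0 ->
    G * Q + s * P - A * s - G * C - G * D - B * s = G * (Q - C - D).
  move=> H; have {H}-> : P = A + B.
    by rewrite -[P](subrK A) -[P - A](subrK B) H; ring.
  by ring.
exact: alg.
Qed.

End Covariant.

(** The cyclic sum contains twelve products of G with a derivative of S; each of the six components
    of G occurs twice, with opposite signs, and so multiplies a difference T. *)
Lemma Bianchi_collect (R : comNzRingType) (n : nat) (G : 'I_n -> 'I_n -> R)
    (dS : 'I_n -> 'I_n -> 'I_n -> R)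
    (dR dC : 'I_n -> 'I_n -> 'I_n -> 'I_n -> 'I_n -> R)
    i j k l m :
  (forall i j k l m, dC i j k l m = dR i j k l m +
    (G j m * dS i k l + - (G k m * dS i j l)
     + (G k l * dS i j m + - (G j l * dS i k m)))) ->
  dR i j k l m + dR j k i l m + dR k i j l m = 0 ->
  let T a b c := dS a b c - dS b a c in
  dC i j k l m + dC j k i l m + dC k i j l m =
  G j m * T i k l + G k m * T j i l + G i m * T k j l
  + G k l * T i j m + G j l * T k i m + G i l * T j k m.
Proof.
move=> E H T; rewrite !E /T -[RHS]addr0 -{}H; ring.
Qed.

(** * The second Bianchi identity in terms of the Weyl tensor *)

Section WeylBianchi.
Variables (R : realType) (n : nat) (U : set 'rV[R]_n) (g : 'rV[R]_n -> 'M[R]_n).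
Hypothesis n_ge3 : (3 <= n)%N.
Hypothesis U_open : open U.
Hypothesis g_smooth : smooth_mx U g.
Hypothesis g_sym : forall x, U x -> forall i j, g x i j = g x j i.
Hypothesis g_unit : {in U, forall x, g x \in unitmx}.
Implicit Types (i j k l m p : 'I_n) (x : 'rV[R]_n).

Let mulgI x : U x -> g x *m ginv g x = 1%:M.
Proof. by move=> Ux; rewrite mulmxV// g_unit ?inE. Qed.

Lemma sum_ricci_low j m x : U x ->
  \sum_p ricci_mixed g j p x * g x p m = ricci g j m x.
Proof.
move=> Ux; transitivity (\sum_q (q == m)%:R * ricci g j q x); last first.
  exact: sum_delta.
under eq_bigr => p _ do rewrite mulr_suml.
rewrite exchange_big; apply: eq_bigr => q _ /=.
have /matrixP/(_ q m) := mulVmx (g_unit (mem_set Ux)).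
rewrite !mxE => <-; rewrite mulr_suml; apply: eq_bigr => p _.
by rewrite /ginv -mulrA mulrC.
Qed.

Lemma ricci_trace k l x : U x ->
  ricci g k l x = - trace (ginv g x) (fun i m => Riem_low g i k x l m).
Proof.
move=> Ux; congr (- _); apply: eq_bigr => i _.
have -> : riemann g i k l i x = (Riem_low g i k x *m ginv g x) l i.
  by rewrite /Riem_low -mulmxA mulgI// mulmx1 mxE.
rewrite mxE; apply: eq_bigr => m _.
by rewrite mulrC (ginv_sym g_sym).
Qed.

Definition schouten_field k l x :=
  schouten (g x) (fun k l => ricci g k l x) (scalar_curvature g x) k l.

(** The scalar curvature part is shared equally by the two occurrences of S in each pair of terms,
    hence the factor 2 in the denominator of [schouten]. *)
Lemma weyl_kulkarni_nomizu j k l m x : U x ->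
  weyl g j k l m x =
  weyl_of (g x) (fun j k l m => Riem_low g j k x l m)
    (fun k l => schouten_field k l x) j k l m.
Proof.
move=> Ux; rewrite /weyl /weyl_mixed sum_weyl.
have D a : \sum_p delta R a p * g x p m = g x a m.
  rewrite -[RHS](sum_delta (fun p => g x p m)).
  by apply: eq_bigr => p _; rewrite /delta eq_sym.
have -> : \sum_p riemann g j k l p x * g x p m = Riem_low g j k x l m.
  by rewrite mxE; apply: eq_bigr => p _; rewrite mxE.
rewrite (D j) (D k).
have -> : \sum_p ricci_mixed g j p x * g x p m = ricci g j m x.
  exact: sum_ricci_low.
have -> : \sum_p ricci_mixed g k p x * g x p m = ricci g k m x.
  exact: sum_ricci_low.
rewrite /weyl_of /kulkarni_nomizu /schouten_field /schouten.
have n3 : (3 : R) <= n%:R by rewrite ler_nat.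
have n1 : n%:R - 1 != 0 :> R by lra.
have n2 : n%:R - 2 != 0 :> R by lra.
move: n1 n2; move: (n%:R) => N n1 n2.
move: (Riem_low _ _ _ _ _ _) (ricci g k l x) (ricci g j l x) (ricci g j m x)
 (ricci g k m x) (scalar_curvature g x) => *.
by field; rewrite n1 n2.
Qed.

Lemma smooth_ricci k l : smooth_on U (ricci g k l).
Proof.
apply: (smoothN U_open); apply: (smooth_sum U_open) => m.
have sR := smooth_Riem U_open g_smooth g_sym g_unit.
apply: (eq_on_smooth U_open) (sR m k l m) => x _.
by rewrite mxE.
Qed.

Lemma smooth_schouten k l : smooth_on U (schouten_field k l).
Proof.
have sg := smooth_ginv U_open g_smooth g_unit.
apply: (smoothB U_open).
  by apply: (smoothM U_open); [exact: smooth_cst|exact: smooth_ricci].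
apply: (smoothM U_open); last exact: g_smooth.
apply: (smoothM U_open); last exact: smooth_cst.
apply: (smooth_sum U_open) => i; apply: (smooth_sum U_open) => j.
by apply: (smoothM U_open); [exact: sg|exact: smooth_ricci].
Qed.

Lemma nabla4_weyl i j k l m x : U x -> nabla4 g (weyl g) i j k l m x =
  nabla4 g (fun j k l m x => Riem_low g j k x l m) i j k l m x +
    (g x j m * nabla2 g schouten_field i k l x
     + - (g x k m * nabla2 g schouten_field i j l x)
     + (g x k l * nabla2 g schouten_field i j m x
        + - (g x j l * nabla2 g schouten_field i k m x))).
Proof.
move=> Ux; have iUx := mem_set Ux.
pose W j k l m x := g x j m * schouten_field k l x.
have dg a b : pderivable U (fun x => g x a b) by exact: smooth_pderivable.
have dS a b : pderivable U (schouten_field a b).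
  exact: smooth_pderivable (smooth_schouten a b).
have dW a b c d : pderivable U (W a b c d).
  apply: smooth_pderivable.
  by apply: (smoothM U_open); [exact: g_smooth|exact: smooth_schouten].
have dN (T : 'I_n -> 'I_n -> 'I_n -> 'I_n -> 'rV[R]_n -> R) :
    pderivable4 U T -> pderivable4 U (fun j k l m x => - T j k l m x).
  move=> dT a b c d y Uy p; apply: derivableN; exact: dT.
have dD (T T' : 'I_n -> 'I_n -> 'I_n -> 'I_n -> 'rV[R]_n -> R) :
    pderivable4 U T -> pderivable4 U T' ->
    pderivable4 U (fun j k l m x => T j k l m x + T' j k l m x).
  move=> dT dT' a b c d y Uy p; apply: derivableD; [exact: dT|exact: dT'].
have nW a b c d : nabla4 g W i a b c d x = g x a d * nabla2 g schouten_field i b c x.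
  have cm := christoffel_metric (g_sym_near U_open g_sym Ux) (g_unit iUx).
  exact: (@nabla4_metric_prod R n U g schouten_field i a b c d x Ux dg dS
            (cm i a d)).
(* The four terms of g /\ S as permutations of the one field [W]: g_jm S_kl, g_km S_jl, g_kl S_jm
   and g_jl S_km. *)
pose W1 j k l m := W j k l m.
pose W2 j k l m := W k j l m.
pose W3 j k l m := W k j m l.
pose W4 j k l m := W j k m l.
pose RR j k l m x := Riem_low g j k x l m.
have dR : pderivable4 U RR.
  move=> a b c d; apply: smooth_pderivable.
  exact: (smooth_Riem_low U_open g_smooth g_sym g_unit a b c d).
have E : forall j k l m, {in U, weyl g j k l m =1 fun x => RR j k l m x +
   ((W1 j k l m x + - W2 j k l m x) + (W3 j k l m x + - W4 j k l m x))}.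
  move=> a b c d y /[!inE] Uy; rewrite weyl_kulkarni_nomizu//.
  rewrite /weyl_of /kulkarni_nomizu /RR /W1 /W2 /W3 /W4 /W; congr (_ + _).
  move: (schouten_field _ _ _) (schouten_field _ _ _)
    (schouten_field _ _ _) (schouten_field _ _ _) => *.
  by ring.
apply: etrans (eq_on_nabla4 g U_open i j k l m E iUx) _.
have d1 : pderivable4 U W1 by exact: dW.
have d2 : pderivable4 U W2 by move=> *; exact: dW.
have d3 : pderivable4 U W3 by move=> *; exact: dW.
have d4 : pderivable4 U W4 by move=> *; exact: dW.
have d12 := dD _ _ d1 (dN _ d2); have d34 := dD _ _ d3 (dN _ d4).
apply: etrans (nabla4D g i j k l m dR (dD _ _ d12 d34) iUx) _; congr (_ + _).
apply: etrans (nabla4D g i j k l m d12 d34 iUx) _; congr (_ + _).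
  apply: etrans (nabla4D g i j k l m d1 (dN _ d2) iUx) _; congr (_ + _).
    exact: nW.
  apply: etrans (nabla4N g i j k l m d2 iUx) _; congr (- _).
  by rewrite -nW; exact: (nabla4_swapl g W).
apply: etrans (nabla4D g i j k l m d3 (dN _ d4) iUx) _; congr (_ + _).
  rewrite -nW; apply: etrans (nabla4_swapl g W4 i j k l m x) _.
  exact: (nabla4_swapr g W).
apply: etrans (nabla4N g i j k l m d4 iUx) _; congr (- _).
by rewrite -nW; exact: (nabla4_swapr g W).
Qed.

Lemma weyl_Bianchi i j k l m x : U x ->
  let T a b c :=
    nabla2 g schouten_field a b c x - nabla2 g schouten_field b a c x in
  nabla4 g (weyl g) i j k l m x + nabla4 g (weyl g) j k i l m x
    + nabla4 g (weyl g) k i j l m x =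
  g x j m * T i k l + g x k m * T j i l + g x i m * T k j l
  + g x k l * T i j m + g x j l * T k i m + g x i l * T j k m.
Proof.
move=> Ux; apply: (@Bianchi_collect _ _ (fun a b => g x a b)
  (fun a b c => nabla2 g schouten_field a b c x)
  (fun i j k l m => nabla4 g (fun j k l m x => Riem_low g j k x l m) i j k l m x)
  (fun i j k l m => nabla4 g (weyl g) i j k l m x)).
  by move=> *; exact: nabla4_weyl.
exact: (nabla4_Riem_low_cyclic U_open g_smooth g_sym g_unit).
Qed.

End WeylBianchi.

(** * The decomposition in a chart and on the manifold *)

Lemma local_weyl_form (R : realType) (n : nat) (U : set 'rV[R]_n)
    (g : 'rV[R]_n -> 'M[R]_n) (alpha : 'I_n -> 'rV[R]_n -> R) x :
  (5 <= n)%N -> open U -> smooth_mx U g ->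
  (forall x, U x -> forall i j, g x i j = g x j i) ->
  {in U, forall x, g x \in unitmx} -> U x ->
  (forall i j k l m,
    nabla4 g (weyl g) i j k l m x = alpha i x * weyl g j k l m x) ->
  sqnorm g alpha x != 0 ->
  let C := fun j k l m => weyl g j k l m x in
  let E := fun i l => weylE g alpha i l x in
  let a := fun i => alpha i x in
  let a2 := sqnorm g alpha x in
  let G := fun i j => g x i j in
  forall j k l m : 'I_n,
    C j k l m =
    (n%:R - 3)^-1 *
      (G m k * E j l - G m j * E k l + G j l * E k m - G k l * E j m)
    - (n%:R - 2) / (n%:R - 3) *
      (a k * a m / a2 * E j l - a j * a m / a2 * E k l
       + a j * a l / a2 * E k m - a k * a l / a2 * E j m).
Proof.
move=> n5 oU sg gs gu Ux rec a2 C E a a2' G j k l m.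
have iUx := mem_set Ux.
have n3 : (3 <= n)%N by exact: leq_trans n5.
have Is := ginv_sym gs Ux; have Gs := gs x Ux.
have GI : g x *m ginv g x = 1%:M by rewrite mulmxV ?gu.
pose Rm j k l m := Riem_low g j k x l m.
pose S k l := schouten_field g k l x.
have Rl p q r s : Rm p q r s = - Rm q p r s by rewrite /Rm Riem_low_anti mxE.
have Rr p q r s : Rm p q r s = - Rm p q s r.
  have /matrixP/(_ s r) := Riem_low_tr oU sg gs gu p q iUx.
  by rewrite mxE [RHS]mxE.
have Rc p q r s : Rm p q r s + Rm q r p s + Rm r p q s = 0.
  exact: (Riem_low_cyclic oU sg gs gu).
have ricE p q : ricci g p q x = ricci_of (ginv g x) Rm p q.
  exact: (ricci_trace gs gu).
have SS p q : S p q = schouten (g x) (ricci_of (ginv g x) Rm)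
    (trace (ginv g x) (ricci_of (ginv g x) Rm)) p q.
  rewrite /S /schouten_field /schouten ricE; congr (_ - _ / _ * _).
  by apply: eq_bigr => i _; apply: eq_bigr => i' _; rewrite ricE.
have CE p q r s : C p q r s = weyl_of (g x) Rm S p q r s.
  exact: (weyl_kulkarni_nomizu n3 gu).
apply: (@curvature_decomposition R n (g x) (ginv g x) Gs Is GI a C
  (fun a b c => nabla2 g (schouten_field g) a b c x
                - nabla2 g (schouten_field g) b a c x)) => //.
- by move=> *; rewrite !CE; exact: weyl_of_antil.
- by move=> *; rewrite !CE; exact: weyl_of_antir.
- by move=> *; rewrite !CE; exact: (weyl_of_cyclic Gs Is Rl Rr Rc SS).
- move=> p q; rewrite -[RHS](weyl_of_tracefree Gs Is GI n3 SS p q).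
  by apply: eq_trace => i i'; exact: CE.
- by move=> p q r; exact: esym (opprB _ _).
(* Read from right to left, the recurrence turns a C back into nabla C. It is used at the point x
   only, since the differentiated identity already holds for every metric. *)
- move=> i p q r s; rewrite /a /C -!rec.
  exact: (weyl_Bianchi n3 oU sg gs gu).
Qed.

Theorem theorem2p3 (R : realType) (n : nat) (hn : (5 <= n)%N)
  (M : manifold R n) (g : metric M) (alpha : covector_field M)
  (hrec : conformally_recurrent g alpha)
  (halpha : forall c : chart R n M, atlas c -> forall x, cimg c x ->
     sqnorm (g c) (alpha c) x != 0) :
  forall c : chart R n M, atlas c -> forall x, cimg c x ->
  let C := fun j k l m => weyl (g c) j k l m x in
  let E := fun i l => weylE (g c) (alpha c) i l x in
  let a := fun i => alpha c i x in
  let a2 := sqnorm (g c) (alpha c) x in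
  let G := fun i j => g c x i j in
  forall j k l m : 'I_n,
    C j k l m =
    (n%:R - 3)^-1 *
      (G m k * E j l - G m j * E k l + G j l * E k m - G k l * E j m)
    - (n%:R - 2) / (n%:R - 3) *
      (a k * a m / a2 * E j l - a j * a m / a2 * E k l
       + a j * a l / a2 * E k m - a k * a l / a2 * E j m).
Proof.
move=> c Ac x cx.
apply: (@local_weyl_form R n (cimg c) (g c) (alpha c) x hn) => //.
- exact: cimg_open.
- by move=> i j; exact: (metric_smooth g Ac).
- by move=> y cy i j; exact: (Defs.metric_sym g Ac cy).
- by move=> y /[!inE] cy; exact: (metric_nondegenerate g Ac cy).
- by move=> *; exact: hrec.2.
- exact: halpha.
Qed.
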